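(* Let $\{|\vartheta_0\rangle,|\vartheta_1\rangle\}$ be an orthonormal basis of $\mathcal H_Q=\mathbb C^2$ and $|\varphi_x\rangle=\tfrac1{\sqrt2}\sum_{z=0}^1(-1)^{xz}|\vartheta_z\rangle$ for $x\in\{0,1\}$; let $Z=|\vartheta_0\rangle\langle\vartheta_0|-|\vartheta_1\rangle\langle\vartheta_1|$ and $X=|\varphi_0\rangle\langle\varphi_0|-|\varphi_1\rangle\langle\varphi_1|$. Let $\theta,\phi\in\mathbb R$, let $\{|0\rangle,|1\rangle\}$ be an orthonormal basis of an ancilla space $\mathcal H_A=\mathbb C^2$, let $|\gamma_k\rangle=\cos\tfrac\theta2|k\rangle+\sin\tfrac\theta2|k+1\rangle$ (addition mod 2), and let $$U_{\rm MZ}=\sum_{x=0}^1e^{ix\phi}|\varphi_x\rangle\langle\varphi_x|_Q\otimes|\gamma_x\rangle_A .$$ Let $\mathcal E_{\rm MZ}$ be the instrument obtained by applying the isometry $U_{\rm MZ}$ and then measuring the ancilla in the basis $\{|0\rangle,|1\rangle\}$, i.e. $\mathcal E_{\rm MZ}(f\otimes a)=\sum_{y=0}^1 f(y)\,U_{\rm MZ}^*(a\otimes|y\rangle\langle y|)U_{\rm MZ}$ for $f\in L^\infty(\{0,1\})$, $a\in\mathcal B(\mathcal H_Q)$. Define the which-way distinguishability $D=\tfrac12\big\||\gamma_0\rangle\langle\gamma_0|-|\gamma_1\rangle\langle\gamma_1|\big\|_1$ and the fringe visibility $V=\max_\varrho\big|\mathrm{Tr}[(Z_Q\otimes\mathbb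 1_A)U_{\rm MZ}\varrho U_{\rm MZ}^*]\big|$, the maximum being over density operators $\varrho$ on $\mathcal H_Q$. Then $$\varepsilon_X(\mathcal E_{\rm MZ})=\tfrac12(1-D)\qquad\text{and}\qquad \nu_Z(\mathcal E_{\rm MZ})=\eta_Z(\mathcal E_{\rm MZ})=\widehat\eta_Z(\mathcal E_{\rm MZ})=\tfrac12(1-V).$$
   Context: Heisenberg picture: a quantum channel is a completely positive unital linear map from the algebra of observables of the output system to that of the input system; $L^\infty(\mathsf S)$ denotes functions on the finite set $\mathsf S$. Here all classical systems take values in $\mathsf X=\mathsf Y=\mathsf Z=\{0,1\}$, and both the input and the quantum output of $\mathcal E=\mathcal E_{\rm MZ}:L^\infty(\mathsf Y)\otimes\mathcal B(\mathcal H_Q)\to\mathcal B(\mathcal H_Q)$ are the qubit $\mathcal H_Q$, so $d=2$. Juxtaposition of channels is composition of maps. Distinguishability: $\delta(\mathcal E_1,\mathcal E_2)=\tfrac12\|\mathcal E_1-\mathcal E_2\|_{\rm cb}$, where $\|T\|_{\rm cb}=\sup_{n\in\mathbb N}\|\mathrm{id}_n\otimes T\|_\infty$ and $\|\cdot\|_\infty$ is the norm of a linear map with respect to operator norms. Ideal devices: $\mathcal Q_X(f)=\sum_xf(x)|\varphi_x\rangle\langle\varphi_x|$, $\mathcal Q_Z(f)=\sum_zf(z)|\vartheta_z\rangle\langle\vartheta_z|$, and $\mathcal P_Z:\mathcal B(\mathcal H_Q)\to L^\infty(\mathsf Z)$, $(\mathcal P_Z(a))(z)=\langle\vartheta_z|a|\vartheta_z\rangle$.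 Error and disturbance measures: - $\varepsilon_X(\mathcal E)=\inf_{\mathcal R}\delta(\mathcal Q_X,\mathcal E_{\mathcal R})$ over channels $\mathcal R:L^\infty(\mathsf X)\to L^\infty(\mathsf Y)$, with $\mathcal E_{\mathcal R}(f)=\mathcal E(\mathcal R(f)\otimes\mathbb 1)$; - $\nu_Z(\mathcal E)=\inf_{\mathcal R}\delta(\mathcal Q_Z,\mathcal E\mathcal R\mathcal Q_Z)$ and $\eta_Z(\mathcal E)=\inf_{\mathcal R}\delta(\mathcal P_Z,\mathcal P_Z\mathcal E\mathcal R)$, both over channels $\mathcal R:\mathcal B(\mathcal H_Q)\to L^\infty(\mathsf Y)\otimes\mathcal B(\mathcal H_Q)$; - $\widehat\eta_Z(\mathcal E)=\tfrac{d-1}d-\inf_{\mathcal C}\delta(\mathcal C,\mathcal P_Z\mathcal E)$ over constant channels $\mathcal C:L^\infty(\mathsf Y)\otimes\mathcal B(\mathcal H_Q)\to L^\infty(\mathsf Z)$, i.e. $\mathcal C(a)=\sigma(a)\mathbb 1$ for a fixed state $\sigma$ on the output algebra. *)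

(* Defs.v *)
From HB Require Import structures.
From mathcomp Require Import all_boot all_order all_algebra.
From mathcomp Require Import sesquilinear spectral.
From mathcomp Require Import complex mxtens.
From mathcomp Require Import boolp classical_sets reals ereal trigo.

Set Implicit Arguments.
Unset Strict Implicit.
Unset Printing Implicit Defensive.
Import Order.TTheory GRing.Theory Num.Theory.
Local Open Scope ring_scope.
Local Open Scope classical_set_scope.
Local Open Scope complex_scope.
Local Open Scope sesquilinear_scope.

(* [alg R S d] is L^oo(S) (x) B(C^d), an element being a family of d x d
   matrices indexed by S.  The two extreme cases are
   - L^oo(S) = [alg R S 1], a function f being encoded by s |-> f(s)%:M;
   - B(C^d)  = [alg R unit d].
   Its amplification M_n (x) L^oo(S) (x) B(C^d) is [alg R S (n * d)]. *)
Notation alg R S d := {ffun S -> 'M[R[i]]_d}.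

Section Algebras.
Variable R : realType.
Local Notation C := R[i].

Definition one_alg (S : finType) d : alg R S d := [ffun=> 1%:M].

Definition tens_alg (S : finType) d (f : alg R S 1) (a : alg R unit d) :
  alg R S d := [ffun s => f s 0 0 *: a tt].

Definition expect n (v : 'cV[C]_n) (A : 'M[C]_n) : C :=
  (v^t* *m A *m v) 0 0.

Definition projector n (v : 'cV[C]_n) : 'M[C]_n := v *m v^t*.

Definition psd n (A : 'M[C]_n) : Prop := forall v : 'cV[C]_n, 0 <= expect v A.

Definition alg_pos (S : finType) d (a : alg R S d) : Prop :=
  forall s, psd (a s).

Definition vnorm n (v : 'cV[C]_n) : R :=
  Num.sqrt (\sum_i Normc.normc (v i 0) ^+ 2).

Definition opnorm n (A : 'M[C]_n) : \bar R :=
  ereal_sup [set (vnorm (A *m v))%:E | v in [set v : 'cV[C]_n | vnorm v <= 1]].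

Definition alg_norm (S : finType) d (a : alg R S d) : \bar R :=
  \big[maxe/0%E]_(s : S) opnorm (a s).

Definition map_norm (S S' : finType) d d' (T : alg R S d -> alg R S' d') :
  \bar R :=
  ereal_sup [set alg_norm (T a) | a in [set a | (alg_norm a <= 1)%E]].

Definition block (S : finType) n d (A : alg R S (n * d)) (i j : 'I_n) :
  alg R S d :=
  [ffun s => \matrix_(k, l) A s (mxtens_index (i, k)) (mxtens_index (j, l))].

(* id_n (x) T, sending \sum_(i, j) E_ij (x) a_ij to \sum_(i, j) E_ij (x) T a_ij *)
Definition amplify n (S S' : finType) d d' (T : alg R S d -> alg R S' d')
  (A : alg R S (n * d)) : alg R S' (n * d') :=
  [ffun s => \sum_i \sum_j delta_mx i j *t T (block A i j) s].

Definition cb_norm (S S' : finType) d d' (T : alg R S d -> alg R S' d') :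
  \bar R :=
  ereal_sup [set map_norm (amplify (n := n) T) | n in [set: nat]].

Definition dist (S S' : finType) d d' (E1 E2 : alg R S d -> alg R S' d') :
  \bar R :=
  ((2^-1)%:E * cb_norm (fun a => (E1 a - E2 a)%R))%E.

Definition completely_positive (S S' : finType) d d'
  (T : alg R S d -> alg R S' d') : Prop :=
  forall n (A : alg R S (n * d)), alg_pos A -> alg_pos (amplify T A).

Definition channel (S S' : finType) d d' (T : alg R S d -> alg R S' d') :
  Prop :=
  [/\ linear T, completely_positive T & T (one_alg S d) = one_alg S' d'].

Definition alg_state (S : finType) d (sigma : alg R S d -> C) : Prop :=
  [/\ scalar sigma, forall a, alg_pos a -> 0 <= sigma a
    & sigma (one_alg S d) = 1].

Definition constant_channel (S S' : finType) d (sigma : alg R S d -> C) :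
  alg R S d -> alg R S' 1 := fun a => [ffun=> (sigma a)%:M].

(* d orthonormal vectors of C^d, hence a basis *)
Definition orthonormal_basis d (b : 'I_d -> 'cV[C]_d) : Prop :=
  forall i j, (b i)^t* *m b j = ((i == j)%:R)%:M.

Definition ideal_meas d (b : 'I_d -> 'cV[C]_d) (f : alg R 'I_d 1) :
  alg R unit d := [ffun=> \sum_x f x 0 0 *: projector (b x)].

Definition ideal_prep d (b : 'I_d -> 'cV[C]_d) (a : alg R unit d) :
  alg R 'I_d 1 := [ffun z => (expect (b z) (a tt))%:M].

(* The symbols of these four quantities are epsilon, nu, eta and hat-eta. *)
Definition meas_error (Y : finType) d (b : 'I_d -> 'cV[C]_d)
  (E : alg R Y d -> alg R unit d) : \bar R :=
  ereal_inf
    [set dist (ideal_meas b) (fun f => E (tens_alg (T f) (one_alg unit d)))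
    | T in [set T : alg R 'I_d 1 -> alg R Y 1 | channel T]].

Definition meas_disturbance (Y : finType) d (b : 'I_d -> 'cV[C]_d)
  (E : alg R Y d -> alg R unit d) : \bar R :=
  ereal_inf
    [set dist (ideal_meas b) (E \o T \o ideal_meas b)
    | T in [set T : alg R unit d -> alg R Y d | channel T]].

Definition prep_disturbance (Y : finType) d (b : 'I_d -> 'cV[C]_d)
  (E : alg R Y d -> alg R unit d) : \bar R :=
  ereal_inf
    [set dist (ideal_prep b) (ideal_prep b \o E \o T)
    | T in [set T : alg R unit d -> alg R Y d | channel T]].

Definition prep_demerit (Y : finType) d (b : 'I_d -> 'cV[C]_d)
  (E : alg R Y d -> alg R unit d) : \bar R :=
  (((d%:R - 1) / d%:R)%:E -
   ereal_inf [set dist (constant_channel 'I_d sigma) (ideal_prep b \o E)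
             | sigma in [set sigma | @alg_state Y d sigma]])%E.

Definition density n (rho : 'M[C]_n) : Prop := psd rho /\ \tr rho = 1.

(* Square root of a positive semidefinite matrix by functional calculus: such
   a B equals invmx P *m diag_mx (spectral_diag B) *m P, P := spectralmx B. *)
Definition psd_sqrt n (B : 'M[C]_n) : 'M[C]_n :=
  invmx (spectralmx B) *m diag_mx (map_mx sqrtC (spectral_diag B))
  *m spectralmx B.

Definition trace_norm n (A : 'M[C]_n) : R :=
  complex.Re (\tr (psd_sqrt (A^t* *m A))).

Definition expi (t : R) : C := cos t +i* sin t.

Definition conj_basis (vt : 'I_2 -> 'cV[C]_2) (x : 'I_2) : 'cV[C]_2 :=
  ((Num.sqrt 2)^-1)%:C *: \sum_(z < 2) (-1) ^+ (x * z)%N *: vt z.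

Definition pauli (b : 'I_2 -> 'cV[C]_2) : 'M[C]_2 :=
  projector (b 0) - projector (b 1).

(* k + 1 is addition in 'I_2, i.e. modulo 2 *)
Definition gamma_vec (anc : 'I_2 -> 'cV[C]_2) (theta : R) (k : 'I_2) :
  'cV[C]_2 :=
  (cos (theta / 2))%:C *: anc k + (sin (theta / 2))%:C *: anc (k + 1).

(* An operator C^2 -> C^2 (x) C^2, the system being the first tensor factor;
   the domain dimension 2 * 1 given by the Kronecker product is converted to 2 *)
Definition U_MZ (vt anc : 'I_2 -> 'cV[C]_2) (theta phi : R) :
  'M[C]_(2 * 2, 2) :=
  \sum_(x < 2) expi (x%:R * phi) *:
    (projector (conj_basis vt x) *t gamma_vec anc theta x : 'M[C]_(2 * 2, 2)).

Definition E_MZ (vt anc : 'I_2 -> 'cV[C]_2) (theta phi : R)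
  (F : alg R 'I_2 2) : alg R unit 2 :=
  let U := U_MZ vt anc theta phi in
  [ffun=> \sum_(y < 2) U^t* *m (F y *t projector (anc y)) *m U].

Definition distinguishability (anc : 'I_2 -> 'cV[C]_2) (theta : R) : R :=
  2^-1 * trace_norm (projector (gamma_vec anc theta 0)
                     - projector (gamma_vec anc theta 1)).

Definition fringe_values (vt anc : 'I_2 -> 'cV[C]_2) (theta phi : R) : set R :=
  let U := U_MZ vt anc theta phi in
  [set Normc.normc (\tr ((pauli vt *t (1%:M : 'M[C]_2)) *m (U *m rho *m U^t*)))
  | rho in [set rho : 'M[C]_2 | density rho]].

Definition visibility (vt anc : 'I_2 -> 'cV[C]_2) (theta phi : R) : R :=
  sup (fringe_values vt anc theta phi).

End Algebras.

(* Main.v *)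
(** Write c = cos (theta / 2), s = sin (theta / 2), and P_x for the projector on
    phi_x.  The Kraus operator of outcome y is diagonal in the basis phi:
    K_y = (1 (x) <y|) U_MZ = sum_x e^(i x phi) <y|gamma_x> P_x, where
    <y|gamma_x> is c if x = y and s otherwise.

    The outcome y is thus obtained from x through a binary symmetric channel of
    total variation |c^2 - s^2| = D, and guessing x from y costs (1 - D) / 2.

    The coherence between phi_0 and phi_1 is multiplied by c s for either
    outcome, up to the phase W = P_0 + e^(i phi) P_1.  Hence the difference of
    the expectations of E(F) in theta_0 and theta_1 is c s times the sum over y
    of the same difference for F_y in the basis W theta_z, and 2 |c s| = V.
    Evaluated on a +-1-valued observable, this identity gives all the lower
    bounds.  Undoing the phase W yields the channel
    a |-> (1 + V) / 2 a + (1 - V) / 2 X a X, where X swaps theta_0 and theta_1;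
    the upper bounds follow because a difference r (T1 - T2) of channels T1, T2
    has cb-norm at most 2 r. *)

From HB Require Import structures.
Require Import Defs.
From mathcomp Require Import all_boot all_order all_algebra.
From mathcomp Require Import sesquilinear spectral.
From mathcomp Require Import complex mxtens.
From mathcomp Require Import ring lra.
From mathcomp Require Import boolp classical_sets reals ereal trigo.

Set Implicit Arguments.
Unset Strict Implicit.
Unset Printing Implicit Defensive.
Import Order.TTheory GRing.Theory Num.Theory Num.Def.
Local Open Scope ring_scope.
Local Open Scope complex_scope.
Local Open Scope sesquilinear_scope.

(** * Adjoints, Kronecker products, inner products and contractions *)

Section Adjoint.
Variable C : numClosedFieldType.

Lemma adjmxM m n p (A : 'M[C]_(m, n)) (B : 'M[C]_(n, p)) :
  (A *m B)^t* = B^t* *m A^t*.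
Proof. by rewrite trmx_mul map_mxM. Qed.

Lemma adjmxD m n (A B : 'M[C]_(m, n)) : (A + B)^t* = A^t* + B^t*.
Proof. by rewrite linearD map_mxD. Qed.

Lemma adjmxZ m n (c : C) (A : 'M[C]_(m, n)) : (c *: A)^t* = conjC c *: A^t*.
Proof. by rewrite linearZ map_mxZ. Qed.

Lemma adjmx1 n : (1%:M : 'M[C]_n)^t* = 1%:M.
Proof. by rewrite trmx1 map_mx1. Qed.

Lemma adjmx_sum (I : finType) m n (F : I -> 'M[C]_(m, n)) :
  (\sum_i F i)^t* = \sum_i (F i)^t*.
Proof. by rewrite raddf_sum -map_mx_sum. Qed.

Lemma adjmx_tens m n p q (A : 'M[C]_(m, n)) (B : 'M[C]_(p, q)) :
  (A *t B)^t* = A^t* *t B^t*.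
Proof. by rewrite trmx_tens; exact: (@map_mxT _ _ conjC). Qed.

Lemma tensmx11 m n : (1%:M : 'M[C]_m) *t (1%:M : 'M[C]_n) = 1%:M.
Proof.
apply/matrixP => i j; case: (mxtens_indexP i) => i1 i2.
case: (mxtens_indexP j) => j1 j2; rewrite tensmxE !mxE -natrM mulnb.
by rewrite (can_eq (@mxtens_indexK m n)).
Qed.

Lemma tensmx_sumr (I : finType) m n p q (A : 'M[C]_(m, n))
  (F : I -> 'M[C]_(p, q)) : A *t (\sum_i F i) = \sum_i A *t F i.
Proof.
apply/matrixP => i j; rewrite summxE !mxE summxE mulr_sumr.
by apply: eq_bigr => k _; rewrite mxE.
Qed.

Lemma mulmx_sandwich_sum (I : finType) m n p q (A : 'M[C]_(m, n))
  (F : I -> 'M[C]_(n, p)) (B : 'M[C]_(p, q)) :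
  A *m (\sum_i F i) *m B = \sum_i A *m F i *m B.
Proof. by rewrite mulmx_sumr mulmx_suml. Qed.

Lemma tensmxZr m n p q (c : C) (A : 'M[C]_(m, n)) (B : 'M[C]_(p, q)) :
  A *t (c *: B) = c *: (A *t B).
Proof. by apply/matrixP => i j; rewrite !mxE mulrCA. Qed.

Lemma tensmxZl m n p q (c : C) (A : 'M[C]_(m, n)) (B : 'M[C]_(p, q)) :
  (c *: A) *t B = c *: (A *t B).
Proof. by apply/matrixP => i j; rewrite !mxE mulrA. Qed.

Lemma tensmxDr m n p q (A : 'M[C]_(m, n)) (B B' : 'M[C]_(p, q)) :
  A *t (B + B') = A *t B + A *t B'.
Proof. by apply/matrixP => i j; rewrite !mxE mulrDr. Qed.

Lemma tensmxDl m n p q (A A' : 'M[C]_(m, n)) (B : 'M[C]_(p, q)) :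
  (A + A') *t B = A *t B + A' *t B.
Proof. by apply/matrixP => i j; rewrite !mxE mulrDl. Qed.

Lemma tensmxBr m n p q (A : 'M[C]_(m, n)) (B B' : 'M[C]_(p, q)) :
  A *t (B - B') = A *t B - A *t B'.
Proof. by apply/matrixP => i j; rewrite !mxE mulrBr. Qed.

Definition dot n (u v : 'cV[C]_n) : C := (u^t* *m v) 0 0.

Lemma dotDl n (u u' v : 'cV[C]_n) : dot (u + u') v = dot u v + dot u' v.
Proof. by rewrite /dot adjmxD mulmxDl mxE. Qed.

Lemma dotDr n (u v v' : 'cV[C]_n) : dot u (v + v') = dot u v + dot u v'.
Proof. by rewrite /dot mulmxDr mxE. Qed.

Lemma dotZl n (c : C) (u v : 'cV[C]_n) : dot (c *: u) v = conjC c * dot u v.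
Proof. by rewrite /dot adjmxZ -scalemxAl mxE. Qed.

Lemma dotZr n (c : C) (u v : 'cV[C]_n) : dot u (c *: v) = c * dot u v.
Proof. by rewrite /dot -scalemxAr mxE. Qed.

Lemma dotNl n (u v : 'cV[C]_n) : dot (- u) v = - dot u v.
Proof. by rewrite -scaleN1r dotZl rmorphN1 mulN1r. Qed.

Lemma dotNr n (u v : 'cV[C]_n) : dot u (- v) = - dot u v.
Proof. by rewrite -scaleN1r dotZr mulN1r. Qed.

Lemma dot_sumr (I : finType) n (u : 'cV[C]_n) (F : I -> 'cV[C]_n) :
  dot u (\sum_i F i) = \sum_i dot u (F i).
Proof. by rewrite /dot mulmx_sumr summxE. Qed.

Lemma dotC n (u v : 'cV[C]_n) : dot v u = conjC (dot u v).
Proof.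
rewrite /dot !mxE rmorph_sum; apply: eq_bigr => i _.
by rewrite !mxE rmorphM /= conjCK mulrC.
Qed.

Lemma dot_ge0 n (v : 'cV[C]_n) : 0 <= dot v v.
Proof.
by rewrite /dot mxE sumr_ge0 // => i _; rewrite !mxE mulrC mul_conjC_ge0.
Qed.

Lemma dot_eq0 n (v : 'cV[C]_n) : dot v v = 0 -> v = 0.
Proof.
rewrite /dot mxE => /eqP; rewrite psumr_eq0 => [/allP h|i _]; last first.
  by rewrite !mxE mulrC mul_conjC_ge0.
apply/matrixP => i j; rewrite (ord1 j) mxE.
have := h i (mem_index_enum _); rewrite !mxE mulf_eq0 conjC_eq0 orbb.
by move/eqP.
Qed.

Lemma dot_adj m n (A : 'M[C]_(m, n)) u v : dot u (A *m v) = dot (A^t* *m u) v.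
Proof. by rewrite /dot adjmxM trmxCK mulmxA. Qed.

Lemma dot_subge0 n (u v : 'cV[C]_n) :
  dot u v + dot v u <= dot u u + dot v v.
Proof.
rewrite -subr_ge0; have := dot_ge0 (u - v).
rewrite !(dotDl, dotDr, dotNl, dotNr).
by congr (_ <= _); ring.
Qed.

Definition contraction m n (A : 'M[C]_(m, n)) : Prop :=
  forall v, dot (A *m v) (A *m v) <= dot v v.

Lemma isometry_contraction m n (A : 'M[C]_(m, n)) :
  A^t* *m A = 1%:M -> contraction A.
Proof. by move=> h v; rewrite dot_adj mulmxA h mul1mx. Qed.

(** With w the image of v, <w, w> is the sum of the <K_i w, A_i K_i v>. By [dot_subge0] twice this
    sum is at most the sum of the |K_i w|^2 + |K_i v|^2, that is |w|^2 + |v|^2, and one |w|^2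
    cancels. *)
Lemma kraus_contraction (I : finType) m n (K : I -> 'M[C]_(m, n))
  (A : I -> 'M[C]_m) :
    \sum_i (K i)^t* *m K i = 1%:M -> (forall i, contraction (A i)) ->
  contraction (\sum_i (K i)^t* *m A i *m K i).
Proof.
move=> K1 Ac v; set w := _ *m v.
have KK u : \sum_i dot (K i *m u) (K i *m u) = dot u u.
  transitivity (dot u (\sum_i ((K i)^t* *m K i) *m u)).
    rewrite dot_sumr; apply: eq_bigr => i _.
    by rewrite -mulmxA [RHS]dot_adj trmxCK.
  by rewrite -mulmx_suml K1 mul1mx.
have wE : \sum_i dot (K i *m w) (A i *m (K i *m v)) = dot w w.
  transitivity (dot w (\sum_i ((K i)^t* *m A i *m K i) *m v)).
    rewrite dot_sumr; apply: eq_bigr => i _.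
    by rewrite -!mulmxA [RHS]dot_adj trmxCK.
  by rewrite -mulmx_suml.
have wE' : \sum_i dot (A i *m (K i *m v)) (K i *m w) = dot w w.
  transitivity (conjC (dot w w)); last by rewrite -dotC.
  by rewrite -[in RHS]wE rmorph_sum; apply: eq_bigr => i _; rewrite [LHS]dotC.
have : \sum_i (dot (K i *m w) (A i *m (K i *m v))
             + dot (A i *m (K i *m v)) (K i *m w))
    <= \sum_i (dot (K i *m w) (K i *m w) + dot (K i *m v) (K i *m v)).
  apply: ler_sum => i _; apply: (le_trans (dot_subge0 _ _)).
  by rewrite lerD2l; exact: Ac.
by rewrite !big_split /= wE wE' !KK lerD2l.
Qed.

End Adjoint.

(** * Expectations, vector norms and operator norms *)

Section Norms.
Variable R : realType.
Local Notation C := R[i].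

Lemma expectE n (v : 'cV[C]_n) A : expect v A = dot v (A *m v).
Proof. by rewrite /expect /dot mulmxA. Qed.

Lemma expectD n (v : 'cV[C]_n) A B : expect v (A + B) = expect v A + expect v B.
Proof. by rewrite !expectE mulmxDl dotDr. Qed.

Lemma expectN n (v : 'cV[C]_n) A : expect v (- A) = - expect v A.
Proof. by rewrite !expectE mulNmx dotNr. Qed.

Lemma expectB n (v : 'cV[C]_n) A B : expect v (A - B) = expect v A - expect v B.
Proof. by rewrite expectD expectN. Qed.

Lemma expectZ n (v : 'cV[C]_n) c A : expect v (c *: A) = c * expect v A.
Proof. by rewrite !expectE -scalemxAl dotZr. Qed.

Lemma expect_sum (I : finType) n (v : 'cV[C]_n) (F : I -> 'M[C]_n) :
  expect v (\sum_i F i) = \sum_i expect v (F i).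
Proof. by rewrite !expectE mulmx_suml dot_sumr; apply: eq_bigr => i _;
  rewrite expectE. Qed.

Lemma expect1 n (v : 'cV[C]_n) : expect v 1%:M = dot v v.
Proof. by rewrite expectE mul1mx. Qed.

Lemma expect_sandwich m n (v : 'cV[C]_n) (K : 'M[C]_(m, n)) A :
  expect v (K^t* *m A *m K) = expect (K *m v) A.
Proof. by rewrite !expectE -!mulmxA [LHS]dot_adj trmxCK. Qed.

Lemma real_complex_normc (x : C) : (Normc.normc x)%:C = `|x|.
Proof. by []. Qed.

Lemma normc_ge0 (x : C) : 0 <= Normc.normc x.
Proof. by case: x => a b; exact: sqrtr_ge0. Qed.

Lemma conj_real_complex (x : R) : conjC (x%:C) = x%:C.
Proof. by apply: conj_Creal; rewrite complex_real. Qed.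

Lemma vnorm_ge0 n (v : 'cV[C]_n) : 0 <= vnorm v.
Proof. exact: sqrtr_ge0. Qed.

Lemma vnorm_sqr n (v : 'cV[C]_n) :
  (vnorm v ^+ 2)%:C = dot v v.
Proof.
rewrite sqr_sqrtr; last by rewrite sumr_ge0 // => i _; rewrite sqr_ge0.
rewrite rmorph_sum /dot mxE; apply: eq_bigr => i _.
by rewrite rmorphXn /= real_complex_normc !mxE normCK mulrC.
Qed.

Lemma vnorm_le n m (v : 'cV[C]_n) (w : 'cV[C]_m) (c : R) : 0 <= c ->
  (vnorm w <= c * vnorm v) = (dot w w <= (c ^+ 2)%:C * dot v v).
Proof.
move=> c0; rewrite -!vnorm_sqr -rmorphM lecR -exprMn.
by rewrite ler_pXn2r // nnegrE ?mulr_ge0 ?vnorm_ge0.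
Qed.

Lemma vnorm_eq1 n (v : 'cV[C]_n) : dot v v = 1 -> vnorm v = 1.
Proof.
move=> v1; have := vnorm_sqr v; rewrite v1 => /complexI /eqP.
by rewrite sqrp_eq1 ?vnorm_ge0 // => /eqP.
Qed.

Lemma vnormZ n (c : R) (v : 'cV[C]_n) : 0 <= c ->
  vnorm (c%:C *: v) = c * vnorm v.
Proof.
move=> c0; apply/eqP; rewrite -(@eqrXn2 _ 2) ?mulr_ge0 ?vnorm_ge0 //.
apply/eqP; suff /complexI : (vnorm (c%:C *: v) ^+ 2)%:C
    = ((c * vnorm v) ^+ 2)%:C by [].
have -> : ((c * vnorm v) ^+ 2)%:C = (c ^+ 2)%:C * dot v v.
  by rewrite -vnorm_sqr -rmorphM exprMn.
by rewrite vnorm_sqr dotZl dotZr conj_real_complex mulrA -rmorphM.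
Qed.

Lemma opnorm_le n (A : 'M[C]_n) (c : R) : 0 <= c ->
  (forall v, dot (A *m v) (A *m v) <= (c ^+ 2)%:C * dot v v) ->
  (opnorm A <= c%:E)%E.
Proof.
move=> c0 h; apply: ge_ereal_sup => _ [v /= v1 <-]; rewrite lee_fin.
have : vnorm (A *m v) <= c * vnorm v by rewrite vnorm_le.
by move/le_trans; apply; rewrite ler_piMr.
Qed.

Lemma le_opnorm n (A : 'M[C]_n) (v : 'cV[C]_n) :
  vnorm v <= 1 -> ((vnorm (A *m v))%:E <= opnorm A)%E.
Proof. by move=> v1; apply: ereal_sup_ubound; exists v. Qed.

Lemma opnorm_ge0 n (A : 'M[C]_n) : (0 <= opnorm A)%E.
Proof.
apply: (@le_trans _ _ (vnorm (A *m 0))%:E); first by rewrite lee_fin vnorm_ge0.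
have v0 : vnorm (0 : 'cV[C]_n) = 0.
  by rewrite -(scale0r (0 : 'cV[C]_n)) -(rmorph0 (real_complex R)) vnormZ //
    mul0r.
by apply: le_opnorm; rewrite v0 ler01.
Qed.

Lemma opnorm_le1P n (A : 'M[C]_n) : (opnorm A <= 1)%E <-> contraction A.
Proof.
split=> [h v|h]; last first.
  by apply: opnorm_le => // v; rewrite expr1n mul1r; exact: h.
have [v0|v0] := eqVneq (vnorm v) 0.
  have : dot v v = 0 by rewrite -vnorm_sqr v0 expr0n.
  by move/dot_eq0 ->; rewrite mulmx0.
have vp : 0 < vnorm v by rewrite lt_def v0 vnorm_ge0.
suff : vnorm (A *m v) <= 1 * vnorm v.
  by rewrite vnorm_le // expr1n mul1r.
have := le_opnorm A (v := (vnorm v)^-1%:C *: v).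
rewrite -scalemxAr !vnormZ ?invr_ge0 ?vnorm_ge0 // mulVf // lexx => /(_ isT).
move/le_trans => /(_ _ h); rewrite lee_fin => h1.
by rewrite mul1r -(ler_pM2l (_ : 0 < (vnorm v)^-1)) ?invr_gt0 // mulVf.
Qed.

Lemma expect_le_opnorm n (A : 'M[C]_n) (v : 'cV[C]_n) : dot v v = 1 ->
  ((Normc.normc (expect v A))%:E <= opnorm A)%E.
Proof.
move=> v1; have h := @le_opnorm _ A v.
apply: le_trans (h _); last by rewrite vnorm_eq1.
rewrite lee_fin -(ler_pXn2r (_ : 0 < 2)%N) ?nnegrE ?vnorm_ge0 ?normc_ge0 //.
rewrite -lecR vnorm_sqr rmorphXn /= real_complex_normc normCK expectE -subr_ge0.
(* Cauchy-Schwarz: the component of [w] orthogonal to the unit vector [v] has squared norm <w, w> -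
   |<v, w>|^2. *)
set w := A *m v; have := dot_ge0 (w - dot v w *: v).
rewrite !(dotDl, dotDr, dotNl, dotNr, dotZl, dotZr) v1 -(dotC v w).
by congr (_ <= _); ring.
Qed.

(** The sign of [c] matters because the maximum over the labels starts from 0. *)
Lemma alg_norm_leP (S : finType) d (a : alg R S d) (c : \bar R) : (0 <= c)%E ->
  (alg_norm a <= c)%E <-> forall s, (opnorm (a s) <= c)%E.
Proof.
move=> c0; split=> [h s|h].
  by apply: le_trans h; rewrite /alg_norm (bigD1 s) //= le_max lexx.
by rewrite /alg_norm; elim/big_ind: _ => // x y xc yc; rewrite ge_max xc.
Qed.

End Norms.

(** * Kraus maps, bounds on the cb-distance, positivity of channels *)

Section Kraus.
Variable R : realType.
Local Notation C := R[i].

(* A channel in Kraus form, the k-th term reading the input at classical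
   label [j k s] to contribute to the output at classical label [s]. *)
Definition kraus (I S S' : finType) d d' (j : I -> S' -> S)
  (K : I -> S' -> 'M[C]_(d, d')) (a : alg R S d) : alg R S' d' :=
  [ffun s => \sum_k (K k s)^t* *m a (j k s) *m K k s].

Definition kraus_unital (I S' : finType) d d' (K : I -> S' -> 'M[C]_(d, d')) :=
  forall s, \sum_k (K k s)^t* *m K k s = 1%:M.

Lemma alg_block_sum (S : finType) n d (A : alg R S (n * d)) s :
  A s = \sum_i \sum_j delta_mx i j *t block A i j s.
Proof.
apply/matrixP => x y; case: (mxtens_indexP x) => x1 x2.
case: (mxtens_indexP y) => y1 y2; rewrite summxE.
rewrite (bigD1 x1) //= summxE (bigD1 y1) //= tensmxE !mxE !ffunE !eqxx mxE
  mul1r.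
rewrite [X in _ + X + _]big1 ?addr0 => [|k ky]; last first.
  by rewrite tensmxE mxE eqxx eq_sym (negbTE ky) mul0r.
rewrite [X in _ + X]big1 ?addr0 // => k kx.
by rewrite summxE big1 // => l _; rewrite tensmxE mxE eq_sym (negbTE kx) mul0r.
Qed.

Lemma kraus_linear (I S S' : finType) d d' (j : I -> S' -> S)
  (K : I -> S' -> 'M[C]_(d, d')) : linear (kraus j K).
Proof.
move=> c a b; apply/ffunP => s; rewrite !ffunE scaler_sumr -big_split /=.
apply: eq_bigr => k _.
by rewrite !ffunE mulmxDr mulmxDl -scalemxAr -scalemxAl.
Qed.


(** Amplified Kraus maps are again Kraus maps, so positivity and contractivity for every n follow
    from the unamplified arguments. *)
Lemma amplify_kraus (I S S' : finType) d d' (j : I -> S' -> S)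
  (K : I -> S' -> 'M[C]_(d, d')) n (A : alg R S (n * d)) :
  amplify (kraus j K) A
  = kraus j (fun k s => (1%:M : 'M[C]_n) *t K k s) A.
Proof.
apply/ffunP => s; rewrite !ffunE.
transitivity (\sum_k \sum_i \sum_l
   (delta_mx i l : 'M[C]_n) *t ((K k s)^t* *m block A i l (j k s) *m K k s)).
  rewrite [RHS]exchange_big; apply: eq_bigr => i _; rewrite [RHS]exchange_big.
  by apply: eq_bigr => l _; rewrite ffunE tensmx_sumr.
apply: eq_bigr => k _; rewrite [in RHS]alg_block_sum.
rewrite mulmx_sumr mulmx_suml; apply: eq_bigr => i _.
rewrite mulmx_sumr mulmx_suml; apply: eq_bigr => l _.
by rewrite adjmx_tens adjmx1 !tensmx_mul mul1mx mulmx1.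
Qed.

Lemma kraus_unital_tens (I S' : finType) d d' (K : I -> S' -> 'M[C]_(d, d')) n :
  kraus_unital K -> kraus_unital (fun k s => (1%:M : 'M[C]_n) *t K k s).
Proof.
move=> K1 s; rewrite -[RHS]tensmx11 -(K1 s) tensmx_sumr.
by apply: eq_bigr => k _; rewrite adjmx_tens adjmx1 tensmx_mul mul1mx.
Qed.

Lemma kraus_alg_contraction (I S S' : finType) d d' (j : I -> S' -> S)
  (K : I -> S' -> 'M[C]_(d, d')) (a : alg R S d) :
    kraus_unital K -> (forall s, contraction (a s)) ->
  forall s, contraction (kraus j K a s).
Proof.
by move=> K1 ac s; rewrite ffunE; apply: kraus_contraction => // k; exact: ac.
Qed.

Lemma kraus_pos (I S S' : finType) d d' (j : I -> S' -> S)
  (K : I -> S' -> 'M[C]_(d, d')) (a : alg R S d) :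
  alg_pos a -> alg_pos (kraus j K a).
Proof.
move=> ap s v; rewrite ffunE expect_sum sumr_ge0 // => k _.
by rewrite expect_sandwich; exact: ap.
Qed.

Lemma kraus_channel (I S S' : finType) d d' (j : I -> S' -> S)
  (K : I -> S' -> 'M[C]_(d, d')) : kraus_unital K -> channel (kraus j K).
Proof.
move=> K1; split; first exact: kraus_linear.
  by move=> n A Ap; rewrite amplify_kraus; exact: kraus_pos.
apply/ffunP => s; rewrite !ffunE -(K1 s); apply: eq_bigr => k _.
by rewrite ffunE mulmx1.
Qed.

Lemma amplify_scale_sub (S S' : finType) d d' (T1 T2 : alg R S d -> alg R S' d')
  (c : C) n (A : alg R S (n * d)) :
  amplify (fun a => c *: (T1 a - T2 a)) A = c *: (amplify T1 A - amplify T2 A).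
Proof.
apply/ffunP => s; rewrite !ffunE -sumrB scaler_sumr; apply: eq_bigr => i _.
rewrite -sumrB scaler_sumr; apply: eq_bigr => j _.
by rewrite !ffunE tensmxZr tensmxBr.
Qed.

(** Source of all upper bounds. Each amplified unital Kraus map is contractive, so the difference of
    two has norm at most 2, and the factor 1/2 in [dist] leaves [c]. *)
Lemma dist_kraus_le (I1 I2 S S' : finType) d d'
  (E1 E2 : alg R S d -> alg R S' d')
  (j1 : I1 -> S' -> S) (K1 : I1 -> S' -> 'M[C]_(d, d'))
  (j2 : I2 -> S' -> S) (K2 : I2 -> S' -> 'M[C]_(d, d')) (c : R) :
    0 <= c -> kraus_unital K1 -> kraus_unital K2 ->
    (forall a, E1 a - E2 a = c%:C *: (kraus j1 K1 a - kraus j2 K2 a)) ->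
  (dist E1 E2 <= c%:E)%E.
Proof.
move=> c0 u1 u2 E12; rewrite /dist (funext E12).
have c2 : 0 <= 2 * c by rewrite mulr_ge0.
suff : (cb_norm (fun a => c%:C *: (kraus j1 K1 a - kraus j2 K2 a))
        <= (2 * c)%:E)%E.
  move=> h; have -> : c%:E = ((2^-1)%:E * (2 * c)%:E)%E.
    by rewrite -EFinM mulKf // pnatr_eq0.
  by apply: lee_wpmul2l; rewrite ?lee_fin ?invr_ge0.
apply: ge_ereal_sup => _ [n _ <-]; apply: ge_ereal_sup => _ [A /= A1 <-].
have {A1} Ac s : contraction (A s).
  by apply/opnorm_le1P; move/alg_norm_leP: A1; apply.
apply/alg_norm_leP => [|s]; first by rewrite lee_fin.
rewrite amplify_scale_sub !amplify_kraus.
have := kraus_alg_contraction j1 (kraus_unital_tens n u1) Ac s.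
have := kraus_alg_contraction j2 (kraus_unital_tens n u2) Ac s.
set B1 := kraus _ _ _; set B2 := kraus _ _ _ => B2c B1c.
clearbody B1 B2; apply: opnorm_le => // v.
rewrite !ffunE -scalemxAl mulmxBl dotZl dotZr conj_real_complex mulrA -rmorphM
  -expr2.
set x := B2 s *m v; set y := B1 s *m v.
have -> : ((2 * c) ^+ 2)%:C = (c ^+ 2)%:C * 2 ^+ 2.
  rewrite exprMn mulrC rmorphM; congr (_ * _); rewrite rmorphXn.
  by congr (_ ^+ 2); exact: rmorph_nat.
rewrite -mulrA; apply: ler_wpM2l; first by rewrite ler0c sqr_ge0.
(* Parallelogram law: the two sides differ by |x + y|^2. *)
have : dot (x - y) (x - y) <= 2 * (dot x x + dot y y).
  rewrite -subr_ge0; have := dot_ge0 (x + y).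
  rewrite !(dotDl, dotDr, dotNl, dotNr).
  by congr (_ <= _); ring.
move/le_trans; apply.
have -> : 2 ^+ 2 * dot v v = 2 * (dot v v + dot v v) by ring.
by rewrite ler_pM2l ?ltr0n //; apply: lerD; [exact: B1c|exact: B2c].
Qed.

Lemma expect_tens1 d (v : 'cV[C]_d) (A : 'M[C]_d) :
  expect ((1%:M : 'M_1) *t v : 'cV[C]_(1 * d)) ((1%:M : 'M_1) *t A)
  = expect v A.
Proof.
have h : ((1%:M : 'M_1) *t v)^t* *m ((1%:M : 'M_1) *t A) *m ((1%:M : 'M_1) *t v)
    = (1%:M : 'M_1) *t (v^t* *m A *m v).
  by rewrite adjmx_tens adjmx1 !tensmx_mul !mul1mx.
have := congr1 (fun M : 'M_(1 * 1) => M (mxtens_index (0, 0)) (mxtens_index (0,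
  0))) h.
rewrite [RHS]tensmxE [X in _ = X * _]mxE eqxx mul1r /expect => <-.
by congr (fun_of_matrix _ _ _); apply: val_inj.
Qed.

(** The amplification with n = 1 suffices: [a] is unitary at each label, hence of norm at most 1,
    and a unit vector tests the norm of its image. *)
Lemma le_cb_norm (S S' : finType) d d' (T : alg R S d -> alg R S' d')
  (a : alg R S d) (s : S') (v : 'cV[C]_d') :
    (forall s, (a s)^t* *m a s = 1%:M) -> dot v v = 1 ->
  ((Normc.normc (expect v (T a s)))%:E <= cb_norm T)%E.
Proof.
move=> aU v1.
pose A : alg R S (1 * d) := [ffun s => (1%:M : 'M_1) *t a s].
have A1 : (alg_norm A <= 1)%E.
  apply/alg_norm_leP => // t; apply/opnorm_le1P/isometry_contraction.
  by rewrite ffunE adjmx_tens tensmx_mul aU adjmx1 mul1mx tensmx11.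
apply: (@le_trans _ _ (map_norm (amplify (n := 1) T))); last first.
  by apply: ereal_sup_ubound; exists 1%N.
apply: (@le_trans _ _ (alg_norm (amplify (n := 1) T A))); last first.
  by apply: ereal_sup_ubound; exists A.
apply: (@le_trans _ _ (opnorm (amplify (n := 1) T A s))); last first.
  by move: (lexx (alg_norm (amplify (n := 1) T A))) => /alg_norm_leP; apply;
     rewrite /alg_norm; elim/big_ind: _ => // [x y x0 y0|t _];
     [rewrite le_max x0|exact: opnorm_ge0].
have -> : amplify (n := 1) T A s = 1%:M *t T a s.
  rewrite ffunE big_ord1 big_ord1.
  have -> : block A 0 0 = a.
    apply/ffunP => t; apply/matrixP => k l.
    by rewrite ffunE mxE ffunE tensmxE mxE eqxx mul1r.
  by congr (_ *t _); apply/matrixP => k l; rewrite !mxE (ord1 k) (ord1 l) eqxx.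
rewrite -(expect_tens1 v); apply: expect_le_opnorm.
by rewrite -expect1 -tensmx11 expect_tens1 expect1.
Qed.

(** Source of all lower bounds. If the difference of two test values is at least 4c, one of them has
    modulus at least 2c, which bounds the cb-norm from below. *)
Lemma le_dist (S S' : finType) d d' (E1 E2 : alg R S d -> alg R S' d')
  (a : alg R S d) (s0 s1 : S') (v0 v1 : 'cV[C]_d') (c : R) :
    (forall s, (a s)^t* *m a s = 1%:M) -> dot v0 v0 = 1 -> dot v1 v1 = 1 ->
    (4 * c)%:C <= (expect v0 (E1 a s0) - expect v0 (E2 a s0))
      - (expect v1 (E1 a s1) - expect v1 (E2 a s1)) ->
  (c%:E <= dist E1 E2)%E.
Proof.
move=> aU h0 h1; set T := fun a => E1 a - E2 a.
have -> : expect v0 (E1 a s0) - expect v0 (E2 a s0) = expect v0 (T a s0).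
  by rewrite /T !ffunE expectB.
have -> : expect v1 (E1 a s1) - expect v1 (E2 a s1) = expect v1 (T a s1).
  by rewrite /T !ffunE expectB.
have t0 := le_cb_norm T s0 aU h0; have t1 := le_cb_norm T s1 aU h1.
set x0 := expect _ _ in t0 *; set x1 := expect _ _ in t1 *.
move=> h.
have {}h : 4 * c <= Normc.normc x0 + Normc.normc x1.
  rewrite -lecR rmorphD /= !real_complex_normc; apply: le_trans (ler_normB _ _).
  (* In the order on complex numbers, anything above a real number is itself real, so it lies below
     its modulus. *)
  by apply: le_trans (real_ler_norm _); rewrite // (ger_real h) complex_real.
have -> : c%:E = ((2^-1)%:E * (2 * c)%:E)%E.
  by rewrite -EFinM mulKf // pnatr_eq0.
rewrite /dist; apply: lee_wpmul2l; rewrite ?lee_fin ?invr_ge0 //.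
have [h2|h2] := leP (2 * c) (Normc.normc x0).
  by apply: le_trans t0; rewrite lee_fin.
by apply: le_trans t1; rewrite lee_fin; lra.
Qed.

Lemma channel_pos (S S' : finType) d d' (T : alg R S d -> alg R S' d') a :
  channel T -> alg_pos a -> alg_pos (T a).
Proof.
case=> _ Tcp _ ap s v.
pose A : alg R S (1 * d) := [ffun s => (1%:M : 'M_1) *t a s].
have Ap : alg_pos A.
  move=> t w; rewrite ffunE.
  (* Every vector of the one-fold amplification is a product vector, so complete positivity at n = 1
     gives positivity. *)
  pose u : 'cV[C]_d := \col_k w (mxtens_index (0, k)) 0.
  have -> : w = (1%:M : 'M_1) *t u :> 'M_(1 * d, 1 * 1).
    apply/matrixP => i j; case: (mxtens_indexP i) => i1 i2.
    case: (mxtens_indexP j) => j1 j2.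
    rewrite tensmxE !mxE (ord1 i1) (ord1 j1) (ord1 j2) eqxx mul1r.
    by congr (w _ _); rewrite [LHS]ord1.
  by rewrite expect_tens1; exact: ap.
have := Tcp _ _ Ap s ((1%:M : 'M_1) *t v).
rewrite ffunE big_ord1 big_ord1.
have -> : block A 0 0 = a.
  apply/ffunP => t; apply/matrixP => k l.
  by rewrite ffunE mxE ffunE tensmxE mxE eqxx mul1r.
have -> : delta_mx 0 0 = 1%:M :> 'M[C]_1.
  by apply/matrixP => k l; rewrite !mxE (ord1 k) (ord1 l) eqxx.
by rewrite expect_tens1.
Qed.

(** Positivity and unitality carry the operator inequalities -1 <= a <= 1 over to [T a]. *)
Lemma channel_expect_bound (S S' : finType) d d'
  (T : alg R S d -> alg R S' d') a s v : channel T ->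
    alg_pos (one_alg R S d - a) -> alg_pos (one_alg R S d + a) ->
  - dot v v <= expect v (T a s) <= dot v v.
Proof.
move=> Tch am ap; have [Tl _ T1] := Tch.
have := channel_pos Tch am s v; have := channel_pos Tch ap s v.
have -> : T (one_alg R S d + a) = one_alg R S' d' + T a.
  by rewrite -T1 -[in LHS](scale1r (one_alg R S d)) Tl scale1r.
have -> : T (one_alg R S d - a) = one_alg R S' d' - T a.
  by rewrite -T1 -[in LHS](scaleN1r a) addrC Tl scaleN1r addrC.
rewrite !ffunE expectD expectB expect1 subr_ge0 => h ->.
by rewrite andbT -subr_ge0 opprK addrC.
Qed.

End Kraus.

Lemma sum_ord2 (V : nmodType) (F : 'I_2 -> V) : \sum_(i < 2) F i = F 0 + F 1.
Proof. by rewrite big_ord_recl big_ord1; congr (_ + F _); apply: val_inj. Qed.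

Lemma ord2_ind (P : 'I_2 -> Prop) : P 0 -> P 1 -> forall i, P i.
Proof.
move=> P0 P1 [[|[|//]] h].
  by have -> : Ordinal h = 0 by apply: val_inj.
by have -> : Ordinal h = 1 by apply: val_inj.
Qed.

Lemma ord2_11 : 1 + 1 = 0 :> 'I_2.
Proof. exact: val_inj. Qed.

(** * Orthonormal bases, the conjugate basis, ideal devices in Kraus form *)

Section Bases.
Variable R : realType.
Local Notation C := R[i].
Implicit Type b : 'I_2 -> 'cV[C]_2.

Lemma orthonormal_dot d (b : 'I_d -> 'cV[C]_d) : orthonormal_basis b ->
  forall i j, dot (b i) (b j) = (i == j)%:R.
Proof. by move=> hb i j; rewrite /dot hb !mxE eqxx. Qed.

Lemma orthonormal_dotP d (b : 'I_d -> 'cV[C]_d) :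
  (forall i j, dot (b i) (b j) = (i == j)%:R) -> orthonormal_basis b.
Proof. by move=> hb i j; rewrite [LHS]mx11_scalar; congr (_%:M); exact: hb. Qed.

Lemma projector_mul d (u v w : 'cV[C]_d) : u *m v^t* *m w = dot v w *: u.
Proof. by rewrite -mulmxA [X in u *m X]mx11_scalar mul_mx_scalar. Qed.

(** Orthonormality says that the matrix with columns [b i] has its adjoint as left inverse; being
    square, it has it as right inverse too. *)
Lemma sum_projector d (b : 'I_d -> 'cV[C]_d) : orthonormal_basis b ->
  \sum_i projector (b i) = 1%:M.
Proof.
move=> hb; pose B : 'M[C]_d := \matrix_(i, j) b j i 0.
have BB : B^t* *m B = 1%:M.
  apply/matrixP => i j; have := congr1 (fun M : 'M_1 => M 0 0) (hb i j).
  rewrite !mxE mulr1n => <-; apply: eq_bigr => k _; rewrite !mxE //.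
rewrite -(mulmx1C BB); apply/matrixP => i j; rewrite summxE mxE.
by apply: eq_bigr => k _; rewrite !mxE big_ord1 !mxE.
Qed.

Lemma adj_projector d (v : 'cV[C]_d) : (projector v)^t* = projector v.
Proof. by rewrite /projector adjmxM trmxCK. Qed.

Lemma orthonormal_unitary d (b : 'I_d -> 'cV[C]_d) (U : 'M[C]_d) :
  orthonormal_basis b -> U^t* *m U = 1%:M ->
  orthonormal_basis (fun i => U *m b i).
Proof.
by move=> hb hU i j; rewrite adjmxM mulmxA -[_ *m _ *m U]mulmxA hU mulmx1.
Qed.

(** The map [s] serves to treat the ideal measurement and the one with swapped outcomes together, as
    the two terms in [dist_kraus_le]. *)
Lemma ideal_meas_kraus d (b : 'I_d -> 'cV[C]_d)
  (s : 'I_d -> 'I_d) (f : alg R 'I_d 1) :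
  kraus (fun k (_ : unit) => s k) (fun k _ => (b k)^t*) f
  = ideal_meas b [ffun k => f (s k)].
Proof.
apply/ffunP => t; rewrite !ffunE; apply: eq_bigr => k _.
by rewrite trmxCK ffunE [f (s k)]mx11_scalar mul_mx_scalar -scalemxAl mxE eqxx
  mulr1n.
Qed.

Lemma meas_unital d (b : 'I_d -> 'cV[C]_d) : orthonormal_basis b ->
  kraus_unital (fun k (_ : unit) => (b k)^t*).
Proof.
move=> hb s; rewrite -(sum_projector hb); apply: eq_bigr => k _.
by rewrite trmxCK.
Qed.

Lemma ideal_prep_kraus d (b : 'I_d -> 'cV[C]_d)
  (s : 'I_d -> 'I_d) (a : alg R unit d) :
  kraus (fun (_ : unit) (_ : 'I_d) => tt) (fun _ z => b (s z)) a
  = [ffun z => ideal_prep b a (s z)].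
Proof.
apply/ffunP => z; rewrite !ffunE (big_pred1 tt) => [|[]//].
by rewrite [LHS]mx11_scalar.
Qed.

Lemma prep_unital d (b : 'I_d -> 'cV[C]_d)
  (s : 'I_d -> 'I_d) : orthonormal_basis b ->
  kraus_unital (fun (_ : unit) z => b (s z)).
Proof.
by move=> hb z; rewrite (big_pred1 tt) => [|[]//]; rewrite hb eqxx.
Qed.

Lemma conj_basis0 b : conj_basis b 0
  = (Num.sqrt 2)^-1%:C *: (b 0 + b 1).
Proof. by rewrite /conj_basis sum_ord2 /= !expr0 !scale1r. Qed.

Lemma conj_basis1 b : conj_basis b 1
  = (Num.sqrt 2)^-1%:C *: (b 0 - b 1).
Proof. by rewrite /conj_basis sum_ord2 /= expr0 expr1 scale1r scaleN1r. Qed.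

Lemma sqr_inv_sqrt2 :
  (Num.sqrt (2 : R))^-1%:C * (Num.sqrt 2)^-1%:C = 2^-1.
Proof.
rewrite -rmorphM -expr2 exprVn sqr_sqrtr // fmorphV; congr (_^-1).
exact: rmorph_nat.
Qed.

Lemma conj_basis_orthonormal b : orthonormal_basis b ->
  orthonormal_basis (conj_basis b).
Proof.
move=> /orthonormal_dot hb; apply: orthonormal_dotP.
have h2 : (2 : C) != 0 by rewrite pnatr_eq0.
apply: ord2_ind; apply: ord2_ind;
  rewrite ?conj_basis0 ?conj_basis1 dotZl dotZr conj_real_complex mulrA
    sqr_inv_sqrt2 !(dotDl, dotDr, dotNl, dotNr) !hb /=; by field.
Qed.

(** As phi_0 and phi_1 are the normalised sum and difference of theta_0 and theta_1, the diagonal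
    dyads cancel in X and the two off-diagonal ones remain. *)
Lemma pauli_conj_basis b : orthonormal_basis b ->
  forall z, pauli (conj_basis b) *m b z = b (z + 1).
Proof.
move=> /orthonormal_dot hb.
have h2 : (2 : C) != 0 by rewrite pnatr_eq0.
have h z : pauli (conj_basis b) *m b z
    = (dot (b 0) (b z)) *: b 1 + (dot (b 1) (b z)) *: b 0.
  rewrite /pauli; move: (conj_basis0 b) (conj_basis1 b).
  move: (conj_basis b 0) (conj_basis b 1) (b 0) (b 1) (b z) => p q u v w -> ->.
  rewrite mulmxBl /projector !projector_mul.
  rewrite !dotZl !scalerA conj_real_complex ![_ * _ * real_complex R _]mulrAC.
  rewrite sqr_inv_sqrt2 dotDl dotDl dotNl.
  move: (dot u w) (dot v w) => x y.
  apply/matrixP => i j; rewrite !mxE; move: (u i j) (v i j) => {}u {}v.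
  by field.
by apply: ord2_ind; rewrite h !hb /= ?add0r ?ord2_11 ?scale0r ?scale1r ?addr0
  ?add0r.
Qed.

End Bases.

(** * Operators diagonal with respect to a decomposition 1 = P + Q *)

(* Locked, since comparing unfolded instances is slow. *)
HB.lock Definition dg (C : numClosedFieldType) n (P Q : 'M[C]_n) (u v : C) :
  'M[C]_n := u *: P + v *: Q.

(** A Schur multiplier: each of the four blocks of [a] relative to P and Q gets its own scalar. *)
HB.lock Definition quad (C : numClosedFieldType) n (P Q : 'M[C]_n)
  (p q r s : C) (a : 'M[C]_n) : 'M[C]_n :=
  p *: (P *m a *m P) + q *: (Q *m a *m Q)
  + r *: (P *m a *m Q) + s *: (Q *m a *m P).

Section Diagonal.
Variables (C : numClosedFieldType) (n : nat).
Implicit Types P Q : 'M[C]_n.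

Definition orthogonal_decomposition P Q : Prop :=
  [/\ P *m P = P, Q *m Q = Q, P *m Q = 0 & Q *m P = 0]
  /\ [/\ P^t* = P, Q^t* = Q & P + Q = 1%:M].

Variables P Q : 'M[C]_n.

Lemma quadD p q r s p' q' r' s' a :
  quad P Q p q r s a + quad P Q p' q' r' s' a
  = quad P Q (p + p') (q + q') (r + r') (s + s') a.
Proof.
rewrite quad.unlock.
move: (P *m a *m P) (Q *m a *m Q) (P *m a *m Q) (Q *m a *m P).
by move=> A B D E; apply/matrixP => i j; rewrite !mxE; ring.
Qed.

Lemma quadZ c p q r s a :
  c *: quad P Q p q r s a = quad P Q (c * p) (c * q) (c * r) (c * s) a.
Proof. by rewrite quad.unlock !scalerDr !scalerA. Qed.

Lemma quadB p q r s p' q' r' s' a :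
  quad P Q p q r s a - quad P Q p' q' r' s' a
  = quad P Q (p - p') (q - q') (r - r') (s - s') a.
Proof. by rewrite -scaleN1r quadZ quadD !mulN1r. Qed.

Lemma dgZ c u v : c *: dg P Q u v = dg P Q (c * u) (c * v).
Proof. by rewrite dg.unlock scalerDr !scalerA. Qed.

Lemma dgD u v u' v' : dg P Q u v + dg P Q u' v' = dg P Q (u + u') (v + v').
Proof. by rewrite dg.unlock !scalerDl addrACA. Qed.

Hypothesis hPQ : orthogonal_decomposition P Q.

Lemma dgM u v u' v' : dg P Q u v *m dg P Q u' v' = dg P Q (u * u') (v * v').
Proof.
have [[PP QQ PQ QP] _] := hPQ.
rewrite dg.unlock !mulmxDl !mulmxDr -!scalemxAl -!scalemxAr PP QQ PQ QP.
by rewrite !scaler0 addr0 add0r !scalerA.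
Qed.

Lemma dg_adj u v : (dg P Q u v)^t* = dg P Q (conjC u) (conjC v).
Proof. by have [_ [Pa Qa _]] := hPQ;
  rewrite dg.unlock adjmxD !adjmxZ Pa Qa. Qed.

Lemma dg1 : dg P Q 1 1 = 1%:M.
Proof. by have [_ [_ _ <-]] := hPQ; rewrite dg.unlock !scale1r. Qed.

Lemma dg_adjM u v : (dg P Q u v)^t* *m dg P Q u v =
  dg P Q (conjC u * u) (conjC v * v).
Proof. by rewrite dg_adj dgM. Qed.

Lemma dg_sandwich u v a :
  (dg P Q u v)^t* *m a *m dg P Q u v
  = quad P Q (conjC u * u) (conjC v * v) (conjC u * v) (conjC v * u) a.
Proof.
rewrite dg_adj quad.unlock dg.unlock !mulmxDl !mulmxDr -!scalemxAl -!scalemxAr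
  !scalerA.
move: (P *m a *m P) (Q *m a *m Q) (P *m a *m Q) (Q *m a *m P).
by move=> A B D E; apply/matrixP => i j; rewrite !mxE; ring.
Qed.

Lemma quad1 a : quad P Q 1 1 1 1 a = a.
Proof.
by rewrite -[RHS]mulmx1 -[RHS]mul1mx -{1}adjmx1 -dg1 mulmxA dg_sandwich rmorph1
  mulr1.
Qed.

Lemma dg_reflection : dg P Q 1 (-1) = P - Q.
Proof. by rewrite dg.unlock scale1r scaleN1r. Qed.

Lemma reflection_adj : (P - Q)^t* = P - Q.
Proof. by rewrite -dg_reflection dg_adj rmorphN1 rmorph1. Qed.

Lemma reflection_sandwich a : (P - Q) *m a *m (P - Q) =
  quad P Q 1 1 (-1) (-1) a.
Proof.
rewrite -{1}reflection_adj -dg_reflection dg_sandwich.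
by rewrite rmorphN1 rmorph1 !mul1r mulrNN !mulr1.
Qed.

(** Conjugation by the reflection P - Q fixes the diagonal blocks and negates the others.
    Subtracting it isolates the coherences, with a factor 2. *)
Lemma dg_cross k l a :
  (dg P Q k l)^t* *m a *m dg P Q k l
    - (P - Q) *m ((dg P Q k l)^t* *m a *m dg P Q k l) *m (P - Q)
  = quad P Q 0 0 (2 * (conjC k * l)) (2 * (conjC l * k)) a.
Proof.
have -> : (P - Q) *m ((dg P Q k l)^t* *m a *m dg P Q k l) *m (P - Q)
    = (dg P Q k (- l))^t* *m a *m dg P Q k (- l).
  have -> : dg P Q k (- l) = dg P Q k l *m (P - Q).
    by rewrite -dg_reflection dgM mulrN !mulr1.
  by rewrite adjmxM reflection_adj !mulmxA.
rewrite !dg_sandwich quadB rmorphN mulrNN !subrr mulrN mulNr !opprK.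
by rewrite -!mulr2n !mulr_natl.
Qed.

(** P absorbs the reflection on either side, and Q does so with two signs that cancel; each diagonal
    block thus equals its own negative. *)
Lemma anticommuting_offdiag a : (P - Q) *m a *m (P - Q) = - a ->
  P *m a *m P = 0 /\ Q *m a *m Q = 0.
Proof.
have [[PP QQ PQ QP] _] := hPQ => h.
have eq0 (A : 'M[C]_n) : - A = A -> A = 0.
  move=> hA; have : 2%:R *: A = 0 by rewrite scaler_nat mulr2n -{1}hA addNr.
  by move/eqP; rewrite scaler_eq0 pnatr_eq0 => /eqP.
have PX : P *m (P - Q) = P by rewrite mulmxBr PP PQ subr0.
have XP : (P - Q) *m P = P by rewrite mulmxBl PP QP subr0.
have QX : Q *m (P - Q) = - Q by rewrite mulmxBr QQ QP sub0r.
have XQ : (P - Q) *m Q = - Q by rewrite mulmxBl QQ PQ sub0r.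
have hP : P *m ((P - Q) *m a *m (P - Q)) *m P = P *m a *m P.
  by rewrite -!mulmxA XP !mulmxA PX.
have hQ : Q *m ((P - Q) *m a *m (P - Q)) *m Q = Q *m a *m Q.
  by rewrite -!mulmxA XQ !mulmxN !mulmxA QX !mulNmx opprK.
split; apply: eq0; [rewrite -{2}hP|rewrite -{2}hQ];
  by rewrite h mulmxN mulNmx.
Qed.

End Diagonal.

Lemma projector_decomposition (R : realType) (p : 'I_2 -> 'cV[R[i]]_2) :
  orthonormal_basis p ->
  orthogonal_decomposition (projector (p 0)) (projector (p 1)).
Proof.
move=> hp; have hd := orthonormal_dot hp; split; split.
- by rewrite [LHS]mulmxA projector_mul hd scale1r.
- by rewrite [LHS]mulmxA projector_mul hd scale1r.
- by rewrite [LHS]mulmxA projector_mul hd scale0r mul0mx.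
- by rewrite [LHS]mulmxA projector_mul hd scale0r mul0mx.
- exact: adj_projector.
- exact: adj_projector.
by rewrite -(sum_projector hp) sum_ord2.
Qed.

(** * Test observables with values 1 and -1 *)

Section Observables.
Variable R : realType.
Local Notation C := R[i].

Lemma psd_projector n (u : 'cV[C]_n) : psd (projector u).
Proof.
move=> v; rewrite /expect /projector -[_ *m _ *m v]mulmxA projector_mul.
rewrite -scalemxAr mxE; have -> : (v^t* *m u) 0 0 =
  conjC (dot u v) by exact: dotC.
exact: mul_conjC_ge0.
Qed.

Lemma psdD n (A B : 'M[C]_n) : psd A -> psd B -> psd (A + B).
Proof. by move=> Ap Bp v; rewrite expectD addr_ge0 ?Ap ?Bp. Qed.

Lemma psd_scalar n (k : C) : 0 <= k -> psd (k%:M : 'M[C]_n).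
Proof.
by move=> k0 v; rewrite -scalemx1 expectZ expect1 mulr_ge0 ?dot_ge0.
Qed.

Definition sign_fun : alg R 'I_2 1 := [ffun z : 'I_2 => ((-1) ^+ z)%:M].

Lemma sign_fun_pos :
  alg_pos (one_alg R 'I_2 1 - sign_fun) /\ alg_pos (one_alg R 'I_2 1 +
    sign_fun).
Proof.
by split=> z; rewrite !ffunE -?raddfB -?raddfD; apply: psd_scalar;
  elim/ord2_ind: z; rewrite /= ?expr0 ?expr1 ?subrr ?opprK ?addr_ge0.
Qed.

Lemma sign_fun_unitary z : (sign_fun z)^t* *m sign_fun z = 1%:M.
Proof.
rewrite ffunE -scalemx1 adjmxZ adjmx1 -scalemxAl -scalemxAr scalerA mulmx1.
by rewrite rmorphXn rmorphN1 -exprMn mulrNN mulr1 expr1n scale1r.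
Qed.

Lemma pauli_sqr (q : 'I_2 -> 'cV[C]_2) : orthonormal_basis q ->
  (pauli q)^t* *m pauli q = 1%:M.
Proof.
move=> hq; have hd := projector_decomposition hq.
rewrite /pauli -dg_reflection (dg_adjM hd) rmorphN1 rmorph1 mulrNN mulr1.
exact: dg1 hd.
Qed.

Lemma expect_pauli (q : 'I_2 -> 'cV[C]_2) : orthonormal_basis q ->
  expect (q 0) (pauli q) = 1 /\ expect (q 1) (pauli q) = -1.
Proof.
move=> /orthonormal_dot hq; rewrite !expectE /pauli !mulmxBl /projector
  !projector_mul.
by rewrite !hq /= !scale0r !scale1r subr0 sub0r dotNr !hq.
Qed.

Lemma channel_expect_real (S S' : finType) d d'
  (T : alg R S d -> alg R S' d') a t v : channel T -> dot v v = 1 ->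
    alg_pos (one_alg R S d - a) /\ alg_pos (one_alg R S d + a) ->
  exists2 k : R, expect v (T a t) = k%:C & -1 <= k <= 1.
Proof.
move=> Tch v1 [am ap]; have := channel_expect_bound t v Tch am ap.
rewrite v1 => /andP[h1 h2].
have : expect v (T a t) \is Num.real by rewrite (ger_real h1) realN real1.
case/complex_realP => k kE; exists k => //; move: h1 h2; rewrite kE => h1 h2.
by rewrite -!lecR h2 rmorphN1 h1.
Qed.

Lemma ler_mul_norm (x k : R) : -1 <= k <= 1 -> x * k <= `|x|.
Proof.
move=> k1; apply: (le_trans (ler_norm _)); rewrite normrM ler_piMr //.
by rewrite ler_norml.
Qed.

End Observables.

(** * The interferometer instrument in Kraus form *)

Section Interferometer.
Variables (R : realType) (p b : 'I_2 -> 'cV[R[i]]_2) (c s : R) (e : R[i]).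
Local Notation C := R[i].
Local Notation P := (projector (p 0)).
Local Notation Q := (projector (p 1)).
Hypothesis hp : orthonormal_basis p.
Hypothesis hb : orthonormal_basis b.
Hypothesis flip_b : forall z, pauli p *m b z = b (z + 1).
Hypothesis cs1 : c ^+ 2 + s ^+ 2 = 1.
Hypothesis e1 : conjC e * e = 1.

(* With c = cos (theta / 2), s = sin (theta / 2) and e = exp (i phi), the scalar
   [amplitude y x] is <y|gamma_x> and [mz_kraus y] is (1 (x) <y|) U_MZ. *)
Definition amplitude (y x : 'I_2) : R := if x == y then c else s.

Definition mz_kraus (y : 'I_2) : 'M[C]_2 :=
  dg P Q ((amplitude y 0)%:C) (e * (amplitude y 1)%:C).

Definition mz (F : alg R 'I_2 2) : alg R unit 2 :=
  [ffun=> \sum_y (mz_kraus y)^t* *m F y *m mz_kraus y].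

Definition phase_gate : 'M[C]_2 := dg P Q 1 e.

Lemma phase_gate_unitary : phase_gate^t* *m phase_gate = 1%:M.
Proof.
rewrite /phase_gate (dg_adjM (projector_decomposition hp)) rmorph1 mulr1 e1.
exact: dg1 (projector_decomposition hp).
Qed.

(* The cross terms of [mz] in the basis [p] carry the factor [c * s] for both
   ancilla outcomes, up to the phases of [phase_gate]. *)
Lemma mz_cross (F : alg R 'I_2 2) :
  mz F tt - pauli p *m mz F tt *m pauli p
  = (c * s)%:C *: \sum_y (phase_gate^t* *m F y *m phase_gate
      - pauli p *m (phase_gate^t* *m F y *m phase_gate) *m pauli p).
Proof.
have hd := projector_decomposition hp.
rewrite ffunE mulmx_sumr mulmx_suml -sumrB scaler_sumr; apply: eq_bigr => y _.
rewrite /pauli /mz_kraus /phase_gate !(dg_cross hd) quadZ;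
  congr (quad _ _ _ _ _ _ _); rewrite ?mulr0 //.
  rewrite rmorph1 mul1r rmorphM /= !conj_real_complex /amplitude.
  by elim/ord2_ind: y => /=; rewrite ?rmorphM; ring.
rewrite rmorphM /= !conj_real_complex /amplitude.
by elim/ord2_ind: y => /=; rewrite ?rmorphM; ring.
Qed.

(** Since X swaps [b 0] and [b 1], the expectation of a - X a X in [b 0] is the difference of the
    two expectations of a; this is applied to both sides of [mz_cross]. *)
Lemma mz_expect_diff (F : alg R 'I_2 2) :
  expect (b 0) (mz F tt) - expect (b 1) (mz F tt)
  = (c * s)%:C * \sum_y
      (expect (phase_gate *m b 0) (F y) - expect (phase_gate *m b 1) (F y)).
Proof.
have hd := projector_decomposition hp.
have flipE a : expect (b 0) (a - pauli p *m a *m pauli p)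
   = expect (b 0) a - expect (b 1) a.
  have := expect_sandwich (b 0) (pauli p) a.
  by rewrite /pauli (reflection_adj hd) -/(pauli p) flip_b add0r expectB => ->.
rewrite -flipE mz_cross expectZ expect_sum; congr (_ * _).
by apply: eq_bigr => y _; rewrite flipE !expect_sandwich.
Qed.

(** Each [p x] is an eigenvector of every Kraus operator; the phase [e] drops out, and the squared
    amplitude is the probability of outcome y. *)
Lemma mz_expect_p (F : alg R 'I_2 2) x :
  expect (p x) (mz F tt)
  = \sum_y (amplitude y x ^+ 2)%:C * expect (p x) (F y).
Proof.
have hv := orthonormal_dot hp.
rewrite ffunE expect_sum; apply: eq_bigr => y _; rewrite expect_sandwich.
have -> : mz_kraus y *m p x
    = ((if x == 0 then 1 else e) * (amplitude y x)%:C) *: p x.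
  rewrite /mz_kraus dg.unlock mulmxDl -!scalemxAl /projector !projector_mul !hv.
  elim/ord2_ind: x => /=; rewrite scale0r scaler0 scale1r ?addr0 ?add0r //.
  by rewrite mul1r.
rewrite !expectE -scalemxAr dotZl dotZr mulrA; congr (_ * _).
have h : conjC (if x == 0 then 1 else e) * (if x == 0 then 1 else e) = 1.
  by case: ifP; rewrite ?rmorph1 ?mulr1.
rewrite rmorphM /= conj_real_complex mulrACA h mul1r.
by rewrite -rmorphM.
Qed.


Lemma mz_kraus_adjM y : (mz_kraus y)^t* *m mz_kraus y
  = dg P Q ((amplitude y 0 ^+ 2)%:C) ((amplitude y 1 ^+ 2)%:C).
Proof.
rewrite /mz_kraus (dg_adjM (projector_decomposition hp)) rmorphM /=.
by rewrite !conj_real_complex mulrACA e1 mul1r -!rmorphM.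
Qed.

Lemma mz_krausE : mz = kraus (fun y (_ : unit) => y) (fun y _ => mz_kraus y).
Proof. by apply/funext => F; apply/ffunP => -[]; rewrite !ffunE. Qed.

Lemma amplitude_sum x : \sum_y amplitude y x ^+ 2 = 1.
Proof.
by rewrite sum_ord2 /amplitude; elim/ord2_ind: x => /=; rewrite -cs1 // addrC.
Qed.

Lemma mz_kraus_unital : kraus_unital (fun y (_ : unit) => mz_kraus y).
Proof.
move=> t; rewrite sum_ord2 !mz_kraus_adjM dgD.
have h x : (amplitude 0 x ^+ 2)%:C + (amplitude 1 x ^+ 2)%:C = 1.
  have := amplitude_sum x; rewrite sum_ord2 => /(congr1 (real_complex R)).
  by rewrite rmorphD.
by rewrite !h (dg1 (projector_decomposition hp)).
Qed.

(** * Lower bounds on error and disturbance *)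

Definition sign_obs : alg R unit 2 := [ffun=> pauli b].

Lemma ideal_meas_dg (q : 'I_2 -> 'cV[C]_2) (f : alg R 'I_2 1) :
  ideal_meas q f tt = dg (projector (q 0)) (projector (q 1)) (f 0 0 0) (f 1 0
    0).
Proof. by rewrite ffunE sum_ord2 dg.unlock. Qed.

Lemma ideal_meas_sign : ideal_meas b (sign_fun R) = sign_obs.
Proof.
apply/ffunP => -[]; rewrite ideal_meas_dg !ffunE !mxE eqxx !mulr1n /=.
by rewrite dg.unlock expr0 expr1 scale1r scaleN1r.
Qed.

Lemma sign_obs_pos :
  alg_pos (one_alg R unit 2 - sign_obs) /\ alg_pos (one_alg R unit 2 +
    sign_obs).
Proof.
have e0 := sum_projector hb; rewrite sum_ord2 in e0.
split=> -[]; rewrite !ffunE -e0 /pauli.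
  have -> (A B : 'M[C]_2) : A + B - (A - B) = B + B.
    by apply/matrixP => i j; rewrite !mxE; ring.
  by apply: psdD; exact: psd_projector.
have -> (A B : 'M[C]_2) : A + B + (A - B) = A + A.
  by apply/matrixP => i j; rewrite !mxE; ring.
by apply: psdD; exact: psd_projector.
Qed.

(** On [sign_fun] the post-processing yields numbers k0, k1 in [-1, 1]. The gap between [p 0] and
    [p 1] is then 2 - (c^2 - s^2)(k0 - k1), at least 2 - 2 |c^2 - s^2|. *)
Lemma meas_error_gap (T : alg R 'I_2 1 -> alg R 'I_2 1) : channel T ->
  ((2^-1 * (1 - `|c ^+ 2 - s ^+ 2|))%:E
    <= dist (ideal_meas p) (fun f => mz (tens_alg (T f) (one_alg R unit 2))))%E.
Proof.
move=> Tch; have hv := orthonormal_dot hp.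
have one1 : dot (1%:M : 'cV[C]_1) 1%:M = 1 by rewrite /dot adjmx1 mulmx1 mxE.
apply: (@le_dist  _ _ _ _ _ _ _ (sign_fun R) tt tt (p 0) (p 1)).
- exact: sign_fun_unitary.
- by rewrite hv.
- by rewrite hv.
have k_ y := channel_expect_real y Tch one1 (sign_fun_pos R).
have [k0 k0E k01] := k_ 0; have [k1 k1E k11] := k_ 1.
have eE x : expect (p x) (mz (tens_alg (T (sign_fun R)) (one_alg R unit 2)) tt)
    = (amplitude 0 x ^+ 2 * k0 + amplitude 1 x ^+ 2 * k1)%:C.
  rewrite mz_expect_p sum_ord2 !ffunE !expectZ !expect1 !hv eqxx !mulr1.
  rewrite rmorphD !rmorphM /= -k0E -k1E /expect adjmx1 !mulmx1 !mul1mx.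
  by [].
have iE x : expect (p x) (ideal_meas p (sign_fun R) tt) = (-1) ^+ x.
  rewrite ideal_meas_dg dg.unlock expectD !expectZ !expectE /projector
    !projector_mul !hv.
  rewrite !dotZr !ffunE !mxE !eqxx !mulr1n.
  by elim/ord2_ind: x; rewrite /= !hv /= ?expr0 ?expr1; ring.
rewrite !eE !iE /amplitude /= expr0 expr1.
have -> : 1 - (c ^+ 2 * k0 + s ^+ 2 * k1)%:C
     - (-1 - (s ^+ 2 * k0 + c ^+ 2 * k1)%:C)
   = (2 - ((c ^+ 2 - s ^+ 2) * k0 + (c ^+ 2 - s ^+ 2) * (- k1)))%:C.
  by ring.
rewrite lecR; have h0 := ler_mul_norm (c ^+ 2 - s ^+ 2) k01.
have h1 : (c ^+ 2 - s ^+ 2) * (- k1) <= `|c ^+ 2 - s ^+ 2|.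
  by apply: ler_mul_norm; rewrite lerNl opprK lerNl andbC.
by move: h0 h1; move: (_ * k0) (_ * - k1) `|_| => x y z h0 h1; lra.
Qed.

(** Shared by both disturbance measures. The ideal difference is 2; by [mz_expect_diff] the actual
    one is c s times a signed sum of four numbers in [-1, 1], hence at most 4 |c s|. *)
Lemma disturbance_gap (T : alg R unit 2 -> alg R 'I_2 2) : channel T ->
  (4 * (2^-1 * (1 - 2 * `|c * s|)))%:C
  <= expect (b 0) (pauli b) - expect (b 0) (mz (T sign_obs) tt)
     - (expect (b 1) (pauli b) - expect (b 1) (mz (T sign_obs) tt)).
Proof.
move=> Tch; have [-> ->] := expect_pauli hb.
have -> (x y : C) : 1 - x - (-1 - y) = 2 - (x - y) by ring.
rewrite mz_expect_diff sum_ord2.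
have hw z : dot (phase_gate *m b z) (phase_gate *m b z) = 1.
  rewrite dot_adj mulmxA phase_gate_unitary mul1mx.
  by rewrite (orthonormal_dot hb) eqxx.
have k_ y z := channel_expect_real y Tch (hw z) sign_obs_pos.
have [k00 -> h00] := k_ 0 0; have [k01 -> h01] := k_ 0 1.
have [k10 -> h10] := k_ 1 0; have [k11 -> h11] := k_ 1 1.
have hN k : -1 <= k <= 1 -> (c * s) * (- k) <= `|c * s|.
  by move=> hk; apply: ler_mul_norm; rewrite lerNl opprK lerNl andbC.
have := ler_mul_norm (c * s) h00; have := hN _ h01.
have := ler_mul_norm (c * s) h10; have := hN _ h11.
move=> a1 a2 a3 a4.
have -> : 2 - (c * s)%:C * (k00%:C - k01%:C
   + (k10%:C - k11%:C))
   = (2 - (c * s * k00 + c * s * (- k01)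
       + (c * s * k10 + c * s * (- k11))))%:C.
  by ring.
rewrite lecR; move: a1 a2 a3 a4.
by move: (_ * k00) (_ * - k01) (_ * k10) (_ * - k11) `|_| => *; lra.
Qed.


(** * Optimal post-processing and the values of error and disturbance *)

Lemma algBE (S : finType) d (x y : alg R S d) t : (x - y) t = x t - y t.
Proof. by rewrite !ffunE. Qed.

Lemma algDE (S : finType) d (x y : alg R S d) t : (x + y) t = x t + y t.
Proof. by rewrite ffunE. Qed.

Lemma algZE (S : finType) d k (x : alg R S d) t : (k *: x) t = k *: x t.
Proof. by rewrite ffunE. Qed.

Definition relabel (k : 'I_2) (f : alg R 'I_2 1) : alg R 'I_2 1 :=
  [ffun y => f (y + k)].

Lemma relabel_channel k : channel (relabel k).
Proof.
have -> : relabel k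
    = kraus (fun (_ : unit) y => y + k) (fun _ _ => (1%:M : 'M[C]_1)).
  apply/funext => f; apply/ffunP => y; rewrite !ffunE (big_pred1 tt) => [|[]//].
  by rewrite adjmx1 mul1mx mulmx1.
by apply: kraus_channel => y; rewrite (big_pred1 tt) => [|[]//];
  rewrite adjmx1 mul1mx.
Qed.

(** The guess y + k of x is a mixture of the sharp measurement and its outcome-swapped version, the
    latter weighted by the error probability. *)
Lemma mz_relabel k (f : alg R 'I_2 1) :
  mz (tens_alg (relabel k f) (one_alg R unit 2)) tt
  = (amplitude 0 k ^+ 2)%:C *: ideal_meas p f tt
    + (amplitude 1 k ^+ 2)%:C *: ideal_meas p (relabel 1 f) tt.
Proof.
rewrite !ideal_meas_dg !dgZ dgD ffunE sum_ord2 !ffunE.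
rewrite -!scalemxAr -!scalemxAl !mulmx1 !mz_kraus_adjM !dgZ dgD.
by congr (dg _ _ _ _); elim/ord2_ind: k;
  rewrite ?add0r ?addr0 ?ord2_11 /amplitude /=; ring.
Qed.

Lemma meas_errorE :
  meas_error p mz = (2^-1 * (1 - `|c ^+ 2 - s ^+ 2|))%:E.
Proof.
apply/le_anti/andP; split; last first.
  apply: le_ereal_inf_tmp => _ [T /= Tch <-]; exact: meas_error_gap.
have c2 : c ^+ 2 = 1 - s ^+ 2 by rewrite -cs1 addrK.
(* The outcomes are swapped exactly when c^2 < s^2, so that the error probability is the smaller of
   the two squares. *)
pose k : 'I_2 := if s ^+ 2 <= c ^+ 2 then 0 else 1.
have kE : amplitude 1 k ^+ 2 = 2^-1 * (1 - `|c ^+ 2 - s ^+ 2|).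
  rewrite /k /amplitude; case: leP => h /=.
    by rewrite ger0_norm ?subr_ge0 // c2; field.
  by rewrite ltr0_norm ?subr_lt0 // c2; field.
apply: ge_ereal_inf; eexists; first by exists (relabel k);
  [exact: relabel_channel|].
rewrite -kE; apply: (@dist_kraus_le _ 'I_2 'I_2 _ _ _ _ _ _
   (fun x _ => x) (fun x _ => (p x)^t*) (fun x _ => x + 1)
   (fun x _ => (p x)^t*)).
- exact: sqr_ge0.
- exact: meas_unital.
- exact: meas_unital.
move=> f; rewrite !ideal_meas_kraus -/(relabel 1 f).
have -> : [ffun x => f x] = f by apply/ffunP => x; rewrite ffunE.
apply/ffunP => -[]; rewrite algZE !algBE mz_relabel.
have -> : (amplitude 0 k ^+ 2)%:C = 1 - (amplitude 1 k ^+ 2)%:C.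
  have := congr1 (real_complex R) (amplitude_sum k);
    rewrite sum_ord2 rmorphD rmorph1.
  by move=> <-; rewrite addrK.
by rewrite scalerBl scale1r opprD opprB addrA addrCA subrr addr0 scalerBr.
Qed.

(* Undoes the phase gate, the phase of the second arm being shifted by pi when
   k = 1 so that the residual fringe contrast is nonnegative. *)
Definition recovery_unitary (k : 'I_2) : 'M[C]_2 :=
  dg P Q 1 ((-1) ^+ k * conjC e).

Definition recovery (k : 'I_2) (a : alg R unit 2) : alg R 'I_2 2 :=
  [ffun=> (recovery_unitary k)^t* *m a tt *m recovery_unitary k].

Lemma sqr_signC (k : 'I_2) : conjC ((-1) ^+ k) * (-1) ^+ k = 1 :> C.
Proof. by rewrite rmorphXn rmorphN1 -exprMn mulrNN mulr1 expr1n. Qed.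

Lemma recovery_channel k : channel (recovery k).
Proof.
have -> : recovery k
    = kraus (fun (_ : unit) (_ : 'I_2) => tt) (fun _ _ => recovery_unitary k).
  by apply/funext => f; apply/ffunP => y;
    rewrite !ffunE (big_pred1 tt) => [|[]//].
apply: kraus_channel => y; rewrite (big_pred1 tt) => [|[]//].
have hd := projector_decomposition hp.
rewrite /recovery_unitary (dg_adjM hd) rmorph1 mulr1 rmorphM /= mulrACA.
by rewrite sqr_signC conjCK mul1r [e * _]mulrC e1 (dg1 hd).
Qed.

(** The phases cancel, so both outcomes multiply the coherences by |c s|, while the diagonal weights
    add up to 1. Subtracting g (a - X a X) multiplies the coherences by 1 - 2 g, which is 2 |c s|
    for the given coefficient. *)
Lemma mz_recovery (k : 'I_2) (a : alg R unit 2) :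
  (-1) ^+ k * (c * s) = `|c * s| ->
  mz (recovery k a) tt = a tt
  - (2^-1 * (1 - 2 * `|c * s|))%:C *: (a tt - pauli p *m a tt *m pauli p).
Proof.
move=> kE; have hd := projector_decomposition hp.
have -> : pauli p *m a tt *m pauli p = quad P Q 1 1 (-1) (-1) (a tt).
  exact: reflection_sandwich hd _.
rewrite -{1 2}(quad1 hd (a tt)) quadB quadZ quadB ffunE.
have E y : (mz_kraus y)^t* *m recovery k a y *m mz_kraus y
    = quad P Q ((amplitude y 0 ^+ 2)%:C) ((amplitude y 1 ^+ 2)%:C)
        (((-1) ^+ k * (c * s))%:C) (((-1) ^+ k * (c * s))%:C) (a tt).
  rewrite ffunE.
  have -> : (mz_kraus y)^t*
      *m ((recovery_unitary k)^t* *m a tt *m recovery_unitary k) *m mz_kraus y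
    = (recovery_unitary k *m mz_kraus y)^t* *m a tt
      *m (recovery_unitary k *m mz_kraus y).
    by rewrite adjmxM !mulmxA.
  rewrite /recovery_unitary /mz_kraus (dgM hd) (dg_sandwich hd) mul1r.
  have -> : (-1) ^+ k * conjC e * (e * (amplitude y 1)%:C)
     = ((-1) ^+ k * amplitude y 1)%:C.
    by rewrite mulrA -[X in X * _]mulrA e1 mulr1 rmorphM /= rmorphXn rmorphN1.
  rewrite !conj_real_complex -!rmorphM.
  congr (quad _ _ _ _ _ _ _); congr (real_complex R _); rewrite -?expr2 //.
  - by rewrite exprMn -exprM mulnC exprM sqrrN expr1n expr1n mul1r.
  - by rewrite /amplitude; elim/ord2_ind: y => /=; ring.
  - by rewrite /amplitude; elim/ord2_ind: y => /=; ring.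
rewrite (eq_bigr _ (fun y _ => E y)) sum_ord2 quadD -!rmorphD kE.
have := amplitude_sum 0; have := amplitude_sum 1; rewrite !sum_ord2 => -> ->.
by congr (quad _ _ _ _ _ _ _); field.
Qed.

Lemma sign_index (x : R) : {k : 'I_2 | (-1) ^+ k * x = `|x|}.
Proof.
have [x0|x0] := leP 0 x; first by exists 0; rewrite expr0 mul1r ger0_norm.
by exists 1; rewrite expr1 mulN1r ltr0_norm.
Qed.

(** The squares of c - s and c + s are nonnegative and equal 1 - 2 c s and 1 + 2 c s. *)
Lemma gap_ge0 : 0 <= 2^-1 * (1 - 2 * `|c * s|).
Proof.
rewrite mulr_ge0 ?invr_ge0 // subr_ge0 -ler_pdivlMl // mulr1 ler_norml.
have h1 := sqr_ge0 (c - s); have h2 := sqr_ge0 (c + s).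
have e1n : (c - s) ^+ 2 = (c ^+ 2 + s ^+ 2) - 2 * (c * s) by ring.
have e2 : (c + s) ^+ 2 = (c ^+ 2 + s ^+ 2) + 2 * (c * s) by ring.
rewrite e1n cs1 in h1; rewrite e2 cs1 in h2.
by apply/andP; split; lra.
Qed.

Lemma ideal_meas_flip (f : alg R 'I_2 1) :
  pauli p *m ideal_meas b f tt *m pauli p = ideal_meas b (relabel 1 f) tt.
Proof.
have pa : (pauli p)^t* = pauli p := reflection_adj (projector_decomposition hp).
have hf z : pauli p *m projector (b z) *m pauli p = projector (b (z + 1)).
  by rewrite -{2}pa /projector mulmxA -mulmxA -adjmxM flip_b.
move: hf; move: (pauli p) => X hf; rewrite !ideal_meas_dg dg.unlock.
rewrite mulmxDr mulmxDl -!scalemxAr -!scalemxAl !hf !ffunE.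
by rewrite !add0r !ord2_11 addrC.
Qed.

Lemma meas_disturbanceE :
  meas_disturbance b mz = (2^-1 * (1 - 2 * `|c * s|))%:E.
Proof.
have hv := orthonormal_dot hb; apply/le_anti/andP; split; last first.
  apply: le_ereal_inf_tmp => _ [T /= Tch <-].
  apply: (@le_dist _ _ _ _ _ _ _ (sign_fun R) tt tt (b 0) (b 1)).
  - exact: sign_fun_unitary.
  - by rewrite hv.
  - by rewrite hv.
  have -> : (mz \o T \o ideal_meas b) (sign_fun R) = mz (T sign_obs).
    by rewrite -ideal_meas_sign.
  have -> : ideal_meas b (sign_fun R) tt =
    pauli b by rewrite ideal_meas_sign ffunE.
  exact: disturbance_gap.
have [k kE] := sign_index (c * s).
apply: ge_ereal_inf; eexists; first by exists (recovery k);
  [exact: recovery_channel|].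
(* Conjugation by X swaps the outcomes, so by [mz_recovery] the difference is the gap times that of
   the ideal and the outcome-swapped measurement. *)
apply: (@dist_kraus_le _ 'I_2 'I_2 _ _ _ _ _ _
   (fun x _ => x) (fun x _ => (b x)^t*) (fun x _ => x + 1)
   (fun x _ => (b x)^t*)).
- exact: gap_ge0.
- exact: meas_unital.
- exact: meas_unital.
move=> f; rewrite !ideal_meas_kraus -/(relabel 1 f).
have -> : [ffun x => f x] = f by apply/ffunP => x; rewrite ffunE.
apply/ffunP => -[]; rewrite algZE !algBE [(_ \o _) f]/(mz (recovery k
  (ideal_meas b f))).
rewrite mz_recovery // ideal_meas_flip.
by rewrite opprB addrC subrK.
Qed.

Lemma dot1 : dot (1%:M : 'cV[C]_1) 1%:M = 1.
Proof. by rewrite /dot adjmx1 mulmx1 mxE. Qed.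

Lemma expect_scalar (x : C) : expect (1%:M : 'cV[C]_1) x%:M = x.
Proof. by rewrite /expect adjmx1 mul1mx mulmx1 mxE eqxx mulr1n. Qed.

Lemma ideal_prepE a z : ideal_prep b a z = (expect (b z) (a tt))%:M.
Proof. by rewrite ffunE. Qed.

Lemma expect_ideal_prep a z : expect 1%:M (ideal_prep b a z) =
  expect (b z) (a tt).
Proof. by rewrite ffunE expect_scalar. Qed.

Lemma prep_disturbanceE :
  prep_disturbance b mz = (2^-1 * (1 - 2 * `|c * s|))%:E.
Proof.
apply/le_anti/andP; split; last first.
  apply: le_ereal_inf_tmp => _ [T /= Tch <-].
  apply: (@le_dist _ _ _ _ _ _ _ sign_obs 0 1 1%:M 1%:M); rewrite ?dot1 //.
    by move=> t; rewrite ffunE; exact: pauli_sqr.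
  have -> : (ideal_prep b \o mz \o T) sign_obs =
    ideal_prep b (mz (T sign_obs)) by [].
  apply: le_trans (disturbance_gap Tch) _; rewrite le_eqVlt; apply/orP; left;
    apply/eqP.
  by congr ((_ - _) - (_ - _)); rewrite [RHS]expect_ideal_prep // ffunE.
have [k kE] := sign_index (c * s).
apply: ge_ereal_inf; eexists; first by exists (recovery k);
  [exact: recovery_channel|].
(* Dually, X a X has in [b z] the expectation of a in [b (z + 1)]: the comparison is with the
   preparation of swapped states. *)
apply: (@dist_kraus_le _ unit unit _ _ _ _ _ _
   (fun _ _ => tt) (fun _ z => b z) (fun _ _ => tt) (fun _ z => b (z + 1))).
- exact: gap_ge0.
- exact: (prep_unital id).
- exact: (prep_unital (fun z => z + 1)).
move=> a; rewrite (ideal_prep_kraus b id) (ideal_prep_kraus b (fun z => z + 1)).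
have pa : (pauli p)^t* = pauli p := reflection_adj (projector_decomposition hp).
apply/ffunP => z; rewrite algZE !algBE.
transitivity ((expect (b z) (a tt))%:M
    - (expect (b z) (mz (recovery k a) tt))%:M : 'M[C]_1).
  by congr (_ - _); exact: ideal_prepE.
transitivity ((2^-1 * (1 - 2 * `|c * s|))%:C
    *: ((expect (b z) (a tt))%:M - (expect (b (z + 1)) (a tt))%:M) : 'M[C]_1);
      last first.
  by congr (_ *: (_ - _)); rewrite [RHS]ffunE [RHS]ffunE.
rewrite mz_recovery // expectB expectZ expectB.
have := expect_sandwich (b z) (pauli p) (a tt); rewrite pa flip_b => ->.
by rewrite -!raddfB /= scale_scalar_mx; congr (_%:M); rewrite opprB addrC subrK.
Qed.


(** * Distance of the prepared outputs from constant channels *)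

Lemma mz_pos F : alg_pos F -> alg_pos (mz F).
Proof. by rewrite mz_krausE; exact: kraus_pos. Qed.

Lemma mz_linear : linear mz.
Proof. by rewrite mz_krausE; exact: kraus_linear. Qed.

Lemma mz1 : mz (one_alg R 'I_2 2) = one_alg R unit 2.
Proof.
rewrite mz_krausE.
by have [] := kraus_channel (fun y (_ : unit) => y) mz_kraus_unital.
Qed.

(** The midpoint of the two output states, which attains the infimum over constant channels. *)
Definition mean_state (F : alg R 'I_2 2) : C :=
  2^-1 * (expect (b 0) (mz F tt) + expect (b 1) (mz F tt)).

Lemma mean_stateP : alg_state mean_state.
Proof.
have hv := orthonormal_dot hb; split.
- move=> k x y; rewrite /mean_state mz_linear algDE algZE !expectD !expectZ.
  move: (expect _ (mz x _)) (expect _ (mz y _)) (expect _ (mz x _)) (expect _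
    (mz y _)).
  by move=> x0 y0 x1 y1; ring.
- move=> a /mz_pos ap; rewrite /mean_state mulr_ge0 ?invr_ge0 //.
  by rewrite addr_ge0 //; exact: ap.
rewrite /mean_state mz1 !ffunE !expect1 !hv /=.
by field.
Qed.

Lemma phase_gate_unitaryr : phase_gate *m phase_gate^t* = 1%:M.
Proof. exact: mulmx1C phase_gate_unitary. Qed.

(** The observable W Z W^*, for either outcome: its expectations in W theta_0 and W theta_1 are 1
    and -1, which makes the difference in [mz_expect_diff] extremal. *)
Definition fringe_obs : alg R 'I_2 2 :=
  [ffun=> phase_gate *m pauli b *m phase_gate^t*].

Lemma fringe_obs_unitary y : (fringe_obs y)^t* *m fringe_obs y = 1%:M.
Proof.
rewrite ffunE !adjmxM trmxCK -!mulmxA [X in _ *m (_ *m X)]mulmxA.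
rewrite phase_gate_unitary mul1mx [X in _ *m X]mulmxA pauli_sqr // mul1mx.
exact: phase_gate_unitaryr.
Qed.

Lemma fringe_obs_expect :
  expect (b 0) (mz fringe_obs tt) - expect (b 1) (mz fringe_obs tt)
  = (4 * (c * s))%:C.
Proof.
have h z y : expect (phase_gate *m b z) (fringe_obs y) = expect (b z) (pauli b).
  rewrite ffunE -{2}[phase_gate]trmxCK expect_sandwich mulmxA
    phase_gate_unitary.
  by rewrite mul1mx.
have [e0 e1n] := expect_pauli hb.
rewrite mz_expect_diff sum_ord2 !h e0 e1n.
by ring.
Qed.

(** A constant channel gives equal values at the labels 0 and 1 and cancels from the difference. The
    order of the labels is chosen by the sign of c s. *)
Lemma demerit_lower (sigma : alg R 'I_2 2 -> C) :
  (`|c * s|%:E <= dist (constant_channel 'I_2 sigma) (ideal_prep b \o mz))%E.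
Proof.
have gapE z w : expect 1%:M (constant_channel 'I_2 sigma fringe_obs z)
    - expect 1%:M ((ideal_prep b \o mz) fringe_obs z)
    - (expect 1%:M (constant_channel 'I_2 sigma fringe_obs w)
    - expect 1%:M ((ideal_prep b \o mz) fringe_obs w))
    = expect (b w) (mz fringe_obs tt) - expect (b z) (mz fringe_obs tt).
  rewrite [(_ \o _) _]/(ideal_prep b (mz fringe_obs)) !expect_ideal_prep.
  rewrite ![constant_channel _ _ _ _]ffunE.
  by ring.
have [cs0|cs0] := leP 0 (c * s).
  apply: (@le_dist _ _ _ _ _ _ _ fringe_obs 1 0 1%:M 1%:M); rewrite ?dot1 //.
    exact: fringe_obs_unitary.
  by rewrite gapE fringe_obs_expect ger0_norm.
apply: (@le_dist _ _ _ _ _ _ _ fringe_obs 0 1 1%:M 1%:M); rewrite ?dot1 //.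
  exact: fringe_obs_unitary.
by rewrite gapE -opprB fringe_obs_expect -rmorphN -mulrN ltr0_norm.
Qed.

(** Kraus vector for preparing the state W theta_z together with a uniformly random outcome, whence
    the factor 1 / sqrt 2. *)
Definition fringe_vec (z : 'I_2) : 'cV[C]_2 :=
  (Num.sqrt 2)^-1%:C *: (phase_gate *m b z).

Lemma fringe_vec_unital k :
  kraus_unital (fun (_ : 'I_2) (z : 'I_2) => fringe_vec (z + k)).
Proof.
move=> z; have hw := orthonormal_unitary hb phase_gate_unitary.
rewrite sum_ord2 /fringe_vec adjmxZ -scalemxAl -scalemxAr scalerA.
rewrite conj_real_complex sqr_inv_sqrt2 hw eqxx -scalerDl.
by have -> : 2^-1 + 2^-1 = 1 :> C by [field]; rewrite scale1r.
Qed.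

Lemma fringe_vec_kraus k (a : alg R 'I_2 2) z :
  kraus (fun y (_ : 'I_2) => y) (fun _ z => fringe_vec (z + k)) a z
  = (2^-1 * \sum_y expect (phase_gate *m b (z + k)) (a y))%:M.
Proof.
rewrite ffunE mulr_sumr raddf_sum; apply: eq_bigr => y _.
rewrite /fringe_vec adjmxZ -!scalemxAl -scalemxAr scalerA.
rewrite conj_real_complex sqr_inv_sqrt2 [X in _ *: X]mx11_scalar
  scale_scalar_mx.
by rewrite /expect.
Qed.

Lemma demerit_upper :
  (dist (constant_channel 'I_2 mean_state) (ideal_prep b \o mz) <= `|c *
    s|%:E)%E.
Proof.
have [k kE] := sign_index (c * s).
(* At label z the midpoint exceeds the actual value by half the difference of the values at z + 1
   and z, to which [mz_expect_diff] applies. The shift by [k] absorbs the sign of c s. *)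
apply: (@dist_kraus_le _ 'I_2 'I_2 _ _ _ _ _ _
   (fun y _ => y) (fun _ z => fringe_vec (z + (k + 1)))
   (fun y _ => y) (fun _ z => fringe_vec (z + k))).
- exact: normr_ge0.
- exact: fringe_vec_unital.
- exact: fringe_vec_unital.
move=> a; apply/ffunP => z; rewrite algZE !algBE !fringe_vec_kraus -kE.
rewrite [(_ \o _) a]/(ideal_prep b (mz a)).
rewrite [ideal_prep b _ _]ffunE [constant_channel _ _ _ _]ffunE.
rewrite -!raddfB /= scale_scalar_mx; congr (_%:M).
have hd := mz_expect_diff a; rewrite /mean_state; rewrite sumrB in hd.
pose S z := \sum_y expect (phase_gate *m b z) (a y).
rewrite -/(S 0) -/(S 1) in hd; rewrite -/(S (z + (k + 1))) -/(S (z + k)).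
have {}hd : expect (b 0) (mz a tt)
  = expect (b 1) (mz a tt) + (c * s)%:C * (S 0 - S 1).
  by rewrite -hd addrC subrK.
move: hd; elim/ord2_ind: z; rewrite ?add0r => ->;
  move: (S) (expect _ _) => {}S d1.
  elim/ord2_ind: k {kE}; rewrite ?add0r ?addr0 ?ord2_11 ?expr0 ?expr1;
    move: (S 0) (S 1) => S0 S1; by field.
elim/ord2_ind: k {kE}; rewrite ?add0r ?addr0 ?ord2_11 ?add0r ?addr0 ?expr0
  ?expr1;
    move: (S 0) (S 1) => S0 S1; by field.
Qed.

Lemma prep_demeritE :
  prep_demerit b mz = (2^-1 * (1 - 2 * `|c * s|))%:E.
Proof.
rewrite /prep_demerit.
have -> : ereal_inf [set dist (constant_channel 'I_2 sigma) (ideal_prep b \o mz)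
    | sigma in [set sigma | @alg_state R 'I_2 2 sigma]] = `|c * s|%:E.
  apply/le_anti/andP; split; last first.
    apply: le_ereal_inf_tmp => _ [sigma _ <-]; exact: demerit_lower.
  apply: ge_ereal_inf; eexists; last exact: demerit_upper.
  by exists mean_state; first exact: mean_stateP.
by rewrite -EFinB; congr (_%:E); field.
Qed.

(** * The observable Z after the interferometer *)

Lemma pauli_offdiag :
  P *m pauli b *m P = 0 /\ Q *m pauli b *m Q = 0.
Proof.
have hd := projector_decomposition hp.
have pa : (pauli p)^t* = pauli p := reflection_adj hd.
have hf z : pauli p *m projector (b z) *m pauli p = projector (b (z + 1)).
  by rewrite -{2}pa /projector mulmxA -mulmxA -adjmxM flip_b.
have anti : pauli p *m pauli b *m pauli p = - pauli b.
  move: (pauli p) hf => X hf.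
  by rewrite /pauli mulmxBr mulmxBl !hf !add0r ord2_11 opprB.
exact: (anticommuting_offdiag hd).
Qed.

(** X Z X = -Z leaves Z without diagonal blocks, so each outcome contributes only its coherence
    factor c s, up to the phase gate. *)
Lemma mz_pauli : mz [ffun=> pauli b] tt
  = (2 * (c * s))%:C *: (phase_gate^t* *m pauli b *m phase_gate).
Proof.
have hd := projector_decomposition hp; have [Z0 Z1] := pauli_offdiag.
have quad0 k l m n : quad P Q k l m n (pauli b) = quad P Q 0 0 m n (pauli b).
  by rewrite quad.unlock Z0 Z1 !scaler0.
have E y : (mz_kraus y)^t* *m [ffun=> pauli b] y *m mz_kraus y
    = (c * s)%:C *: (phase_gate^t* *m pauli b *m phase_gate).
  rewrite ffunE /mz_kraus /phase_gate !(dg_sandwich hd) quad0 [X in _ *: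
    X]quad0 quadZ.
  congr (quad _ _ _ _ _ _ _); rewrite ?mulr0 // rmorphM /= ?rmorphM
    !conj_real_complex.
    by rewrite rmorph1 /amplitude; elim/ord2_ind: y => /=; ring.
  by rewrite /amplitude; elim/ord2_ind: y => /=; ring.
rewrite ffunE (eq_bigr _ (fun y _ => E y)) sum_ord2 -scalerDl -rmorphD.
by congr (real_complex R _ *: _); ring.
Qed.

Definition fringe_basis (z : 'I_2) : 'cV[C]_2 := phase_gate^t* *m b z.

Lemma fringe_basis_orthonormal : orthonormal_basis fringe_basis.
Proof. by apply: orthonormal_unitary => //;
  rewrite trmxCK phase_gate_unitaryr. Qed.

Lemma mz_pauli_trace rho : \tr (mz [ffun=> pauli b] tt *m rho)
  = (2 * (c * s))%:C
    * (expect (fringe_basis 0) rho - expect (fringe_basis 1) rho).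
Proof.
rewrite mz_pauli -scalemxAl mxtraceZ; congr (_ * _).
have trE u : \tr (phase_gate^t* *m projector u *m phase_gate *m rho)
    = expect (phase_gate^t* *m u) rho.
  have -> : phase_gate^t* *m projector u *m phase_gate *m rho
      = (phase_gate^t* *m u) *m (u^t* *m phase_gate *m rho).
    by rewrite /projector !mulmxA.
  by rewrite mxtrace_mulC trace_mx11 /expect adjmxM trmxCK !mulmxA.
transitivity (\tr (phase_gate^t* *m projector (b 0) *m phase_gate *m rho)
    - \tr (phase_gate^t* *m projector (b 1) *m phase_gate *m rho)).
  rewrite -raddfB /= /pauli; congr (\tr _).
  move: (phase_gate) (projector _) (projector _) => G A B.
  by rewrite mulmxBr !mulmxBl.
by congr (_ - _); exact: trE.
Qed.

End Interferometer.

(** * Trace norm and which-way distinguishability *)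

Section TraceNorm.
Variable R : realType.
Local Notation C := R[i].

(** The diagonalising matrix is left unspecified, but it commutes with scalar matrices, which forces
    every eigenvalue to be [k]. *)
Lemma psd_sqrt_scalar n (k : C) : psd_sqrt (k%:M : 'M[C]_n) = (sqrtC k)%:M.
Proof.
set A := k%:M; have An : A \is normalmx.
  by apply/normalmxP; rewrite /A tr_scalar_mx map_scalar_mx -!scalar_mxM mulrC.
have /orthomx_spectralP AE := An; have U := spectral_unit A.
have dk j : spectral_diag A 0 j = k.
  have : spectralmx A *m A = diag_mx (spectral_diag A) *m spectralmx A.
    by rewrite {2}AE -mulmxA mulKVmx.
  rewrite /A scalar_mxC => /(congr1 (mulmx^~ (invmx (spectralmx A)))).
  rewrite !mulmxK // => /matrixP /(_ j j).
  by rewrite !mxE eqxx !mulr1n.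
rewrite /psd_sqrt; have -> : map_mx sqrtC (spectral_diag A) =
  const_mx (sqrtC k).
  by apply/rowP => j; rewrite !mxE dk.
by rewrite diag_const_mx -mulmxA -scalar_mxC mulKmx.
Qed.

(** Both projectors have the same cross terms cos sin, which cancel. *)
Lemma gamma_pauli (anc : 'I_2 -> 'cV[C]_2) (theta : R) :
  projector (gamma_vec anc theta 0) - projector (gamma_vec anc theta 1)
  = (cos (theta / 2) ^+ 2 - sin (theta / 2) ^+ 2)%:C *: pauli anc.
Proof.
rewrite /gamma_vec /pauli add0r ord2_11.
move: (cos _) (sin _) (anc 0) (anc 1) => c s u v.
rewrite /projector; apply/matrixP => i j; rewrite !mxE !big_ord1 !mxE.
by rewrite !(rmorphD, rmorphM) /= !conj_real_complex; ring.
Qed.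

Lemma distinguishabilityE (anc : 'I_2 -> 'cV[C]_2) (theta : R) :
  orthonormal_basis anc -> distinguishability anc theta
  = `|cos (theta / 2) ^+ 2 - sin (theta / 2) ^+ 2|.
Proof.
move=> ha; rewrite /distinguishability gamma_pauli /trace_norm.
move: (_ - _) => x.
rewrite adjmxZ conj_real_complex -scalemxAl -scalemxAr scalerA pauli_sqr //
  scalemx1.
rewrite psd_sqrt_scalar mxtrace_scalar.
(* The modulus is what the square root returns, as [sqrtC] picks the nonnegative root. *)
have -> : x%:C * x%:C = `|x|%:C ^+ 2.
  by rewrite -rmorphXn -rmorphM /= real_normK ?num_real.
rewrite sqrCK ?ler0c //.
have -> : `|x|%:C *+ 2 = (2 * `|x|)%:C by ring.
by rewrite /= mulKf // pnatr_eq0.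
Qed.

End TraceNorm.

(** * From the isometry to the Kraus operators, and the fringe visibility *)

Section Link.
Variable R : realType.
Local Notation C := R[i].

Lemma expi_unit (t : R) : conjC (expi t) * expi t = 1.
Proof. by rewrite -normCKC -add_Re2_Im2 /= cos2Dsin2. Qed.

Lemma expi0 : expi (0 : R) = 1.
Proof. by rewrite /expi cos0 sin0. Qed.

Lemma tensmx_dim1 (A : 'M[C]_2) : (A *t (1%:M : 'M[C]_1) : 'M[C]_(2 * 1)) = A.
Proof.
rewrite tens_mx_scalar scale1r; apply/matrixP => i j.
by rewrite castmxE; congr (A _ _); apply: val_inj.
Qed.

(** By orthonormality of the ancilla basis, the projector on [anc y] retains only the term y of U on
    either side. *)
Lemma tens_isometry (K : 'I_2 -> 'M[C]_2) (anc : 'I_2 -> 'cV[C]_2) A y :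
  orthonormal_basis anc ->
  let U : 'M[C]_(2 * 2, 2 * 1) := \sum_z K z *t anc z in
  (U^t* *m (A *t projector (anc y)) *m U : 'M[C]_2) = (K y)^t* *m A *m K y.
Proof.
move=> ha U; rewrite -[RHS]tensmx_dim1 /U adjmx_sum mulmx_suml mulmx_suml.
have hU z : (K z *t anc z)^t* *m (A *t projector (anc y)) *m U
    = (z == y)%:R *: (((K y)^t* *m A *m K y) *t (1%:M : 'M_1)).
  rewrite adjmx_tens tensmx_mul mulmxA ha.
  rewrite mul_scalar_mx tensmxZr -scalemxAl.
  case: eqP => [->|_]; last by rewrite !scale0r.
  rewrite !scale1r /U mulmx_sumr (bigD1 y) //= tensmx_mul ha eqxx.
  rewrite big1 ?addr0 // => w wy.
  by rewrite tensmx_mul ha eq_sym (negbTE wy) raddf0 tensmx0.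
rewrite (eq_bigr _ (fun z _ => hU z)) (bigD1 y) //= eqxx scale1r.
by rewrite big1 ?addr0 // => z /negbTE ->; rewrite scale0r.
Qed.

Variables (vt anc : 'I_2 -> 'cV[C]_2) (theta phi : R).
Hypothesis hanc : orthonormal_basis anc.
Local Notation c := (cos (theta / 2)).
Local Notation s := (sin (theta / 2)).
Local Notation K := (mz_kraus (conj_basis vt) c s (expi phi)).

Lemma U_MZE :
  U_MZ vt anc theta phi = (\sum_z K z *t anc z : 'M[C]_(2 * 2, 2 * 1)).
Proof.
rewrite /U_MZ !sum_ord2 /mz_kraus dg.unlock /gamma_vec /amplitude /=.
rewrite mul0r mul1r expi0 add0r ord2_11.
move: (projector _) (projector _) (anc 0) (anc 1) (expi _) => P Q u v e.
move: (c) (s) => {}c {}s.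
rewrite !tensmxDl !tensmxDr !tensmxZl !tensmxZr !scale1r !scalerDr !scalerA.
move: (P *t u : 'M[C]_(2 * 2, 2 * 1)) (P *t v : 'M[C]_(2 * 2, 2 * 1)).
move: (Q *t u : 'M[C]_(2 * 2, 2 * 1)) (Q *t v : 'M[C]_(2 * 2, 2 * 1)).
move=> D E A B; apply/matrixP => i j; rewrite !mxE; ring.
Qed.

Lemma E_MZE : E_MZ vt anc theta phi = mz (conj_basis vt) c s (expi phi).
Proof.
apply/funext => F; apply/ffunP => -[]; rewrite [LHS]ffunE [RHS]ffunE.
apply: eq_bigr => y _; rewrite U_MZE; exact: tens_isometry.
Qed.

(** After cycling the trace, the identity on the ancilla is split into the projectors on [anc y]:
    ignoring the outcome is summing over it. *)
Lemma fringe_value rho :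
  \tr ((pauli vt *t (1%:M : 'M[C]_2))
    *m (U_MZ vt anc theta phi *m rho *m (U_MZ vt anc theta phi)^t*))
  = \tr (mz (conj_basis vt) c s (expi phi) [ffun=> pauli vt] tt *m rho).
Proof.
rewrite -E_MZE ffunE mulmxA mxtrace_mulC !mulmxA; congr (\tr (_ *m _)).
rewrite -(sum_projector hanc) tensmx_sumr.
etransitivity; first exact: mulmx_sandwich_sum.
by apply: eq_bigr => y _; rewrite ffunE.
Qed.

Hypothesis hvt : orthonormal_basis vt.

Lemma cs_half : c ^+ 2 + s ^+ 2 = 1.
Proof. exact: cos2Dsin2. Qed.

Local Notation w := (fringe_basis (conj_basis vt) vt (expi phi)).

Lemma fringe_valueE rho :
  \tr ((pauli vt *t (1%:M : 'M[C]_2))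
    *m (U_MZ vt anc theta phi *m rho *m (U_MZ vt anc theta phi)^t*))
  = (2 * (c * s))%:C * (expect (w 0) rho - expect (w 1) rho).
Proof.
rewrite fringe_value; apply: mz_pauli_trace.
- exact: conj_basis_orthonormal.
- exact: pauli_conj_basis.
Qed.

Lemma fringe_basis_vt : orthonormal_basis w.
Proof.
by apply: fringe_basis_orthonormal => //;
  [exact: conj_basis_orthonormal|exact: expi_unit].
Qed.

Lemma normc_real (x : R) : Normc.normc (x%:C) = `|x|.
Proof. by rewrite /= expr0n addr0 sqrtr_sqr. Qed.

Lemma fringe_values_max :
  fringe_values vt anc theta phi (2 * `|c * s|).
Proof.
have hw := orthonormal_dot fringe_basis_vt.
(* The pure state [w 0] has expectations 1 and 0 in the fringe basis, the largest possible
   contrast. *)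
exists (projector (w 0)).
  split; first exact: psd_projector.
  by rewrite /projector mxtrace_mulC trace_mx11; have := hw 0 0.
rewrite fringe_valueE.
have -> : expect (w 0) (projector (w 0)) = 1.
  by rewrite expectE /projector projector_mul !hw scale1r hw.
have -> : expect (w 1) (projector (w 0)) = 0.
  by rewrite expectE /projector projector_mul hw scale0r /dot mulmx0 mxE.
by rewrite subr0 mulr1 normc_real normrM ger0_norm.
Qed.

Lemma fringe_values_le v :
  fringe_values vt anc theta phi v -> v <= 2 * `|c * s|.
Proof.
move=> [rho [rp r1] <-]; rewrite fringe_valueE Normc.normcM normc_real normrM
  ger0_norm //.
(* The two expectations are nonnegative and sum to the trace 1, so their difference has modulus at
   most 1. *)
have e1 : expect (w 0) rho + expect (w 1) rho = 1.
  rewrite -r1 -[in RHS](mul1mx rho) -(sum_projector fringe_basis_vt) sum_ord2.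
  have trE u : \tr (projector u *m rho) = expect u rho.
    by rewrite /projector -mulmxA mxtrace_mulC trace_mx11.
  rewrite -(trE (w 0)) -(trE (w 1)) -raddfD /=; congr (\tr _).
  by move: (projector _) (projector _) => A B; rewrite mulmxDl.
have := rp (w 0); have := rp (w 1);
  move: (expect _ _) (expect _ _) e1 => x y e1 y0 x0.
apply: ler_piMr; first by rewrite mulr_ge0.
suff : `|y - x| <= 1 by rewrite -real_complex_normc -(rmorph1 (real_complex R))
  lecR.
by apply: (le_trans (ler_normB _ _)); rewrite !ger0_norm // e1.
Qed.

Lemma visibilityE : visibility vt anc theta phi = 2 * `|c * s|.
Proof.
apply/le_anti/andP; split.
  by apply: ge_sup; [exists (2 * `|c * s|);
    exact: fringe_values_max|exact: fringe_values_le].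
apply: ub_le_sup; last exact: fringe_values_max.
by exists (2 * `|c * s|); exact: fringe_values_le.
Qed.

End Link.

Theorem mainTheorem4 (R : realType) (vt anc : 'I_2 -> 'cV[R[i]]_2)
  (theta phi : R)
  (hvt : orthonormal_basis vt) (hanc : orthonormal_basis anc) :
  let E := E_MZ vt anc theta phi in
  let D := distinguishability anc theta in
  let V := visibility vt anc theta phi in
  (* the supremum defining V is a maximum *)
  [/\ fringe_values vt anc theta phi V,
      meas_error (conj_basis vt) E = (2^-1 * (1 - D))%:E,
      meas_disturbance vt E = (2^-1 * (1 - V))%:E,
      prep_disturbance vt E = (2^-1 * (1 - V))%:E
    & prep_demerit vt E = (2^-1 * (1 - V))%:E].
Proof.
move=> E D V; rewrite /V /D /E visibilityE // distinguishabilityE // E_MZE //.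
have hp := conj_basis_orthonormal hvt; have fl := pauli_conj_basis hvt.
have cs := cs_half theta; have e1 := expi_unit phi.
split.
- exact: fringe_values_max.
- exact: meas_errorE.
- exact: meas_disturbanceE.
- exact: prep_disturbanceE.
- exact: prep_demeritE.
Qed.
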